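(* Let $G_m$ be a bounded Vilenkin group, $0<p\le1/2$, and let $\{q_k:k\ge0\}$ be a non-increasing sequence of non-negative numbers with $q_0>0$. Then the maximal operator $$\widetilde T_p^*f:=\sup_{n\in\mathbb{N}_+}\frac{|T_nf|}{(n+1)^{1/p-2}\log^{2[1/2+p]}(n+1)}$$ is bounded from the Hardy space $H_p$ to the space $L_p$. Here $[1/2+p]$ denotes the integer part of $1/2+p$.
   Context: Let $m=(m_0,m_1,\ldots)$ be a fixed sequence of integers $m_k\ge 2$ with $\sup_k m_k<\infty$. $G_m=\prod_{k\ge0}Z_{m_k}$, $Z_{m_k}=\{0,\ldots,m_k-1\}$ the integers mod $m_k$, is the bounded Vilenkin group with product (of discrete) topology and normalized Haar measure $\mu$. $I_0(x)=G_m$, $I_n(x)=\{y\in G_m: y_0=x_0,\ldots,y_{n-1}=x_{n-1}\}$. $M_0=1$, $M_{k+1}=m_kM_k$; every $n\in\mathbb{N}$ is uniquely $n=\sum_j n_jM_j$ with $n_j\in Z_{m_j}$. $r_k(x)=\exp(2\pi i x_k/m_k)$ and $\psi_n=\prod_k r_k^{n_k}$ (Vilenkin system). $\mathbb{N}_+=\{1,2,\ldots\}$, $\mathbb{N}=\mathbb{N}_+\cup\{0\}$. For $f\in L_1(G_m)$: $\widehat f(n)=\int_{G_m} f\overline{\psi_n}\,d\mu$; $S_0f=0$, $S_nf=\sum_{k=0}^{n-1}\widehat f(k)\psi_k$. $\|g\|_p=(\int_{G_m}|g|^pd\mu)^{1/p}$. Let $\mathcal F_n$ be the $\sigma$-algebra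 generated by the sets $I_n(x)$, $x\in G_m$. A martingale is a sequence $f=(f^{(n)}:n\in\mathbb{N})$ of integrable functions with $f^{(n)}$ $\mathcal F_n$-measurable and $S_{M_n}f^{(l)}=f^{(n)}$ for $n\le l$. $f^*=\sup_n|f^{(n)}|$; $H_p$ ($0<p<\infty$) is the space of martingales with $\|f\|_{H_p}:=\|f^*\|_p<\infty$. For a martingale, $\widehat f(i)=\lim_{k\to\infty}\int_{G_m}f^{(k)}\overline{\psi_i}\,d\mu$ and $S_nf=\sum_{k=0}^{n-1}\widehat f(k)\psi_k$. $T$ means: $T_nf=\frac1{Q_n}\sum_{k=0}^{n-1}q_kS_kf$ with $Q_n=\sum_{k=0}^{n-1}q_k$. An operator $A$ is bounded from $H_p$ to $L_p$ if there is a constant $C$ with $\|Af\|_p\le C\|f\|_{H_p}$ for all $f\in H_p$. *)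

(* Defs.v *)
From HB Require Import structures.
From mathcomp Require Import all_boot all_order all_algebra.
From mathcomp Require Import archimedean.
From mathcomp Require Import zify.
From mathcomp Require Import complex.
From mathcomp Require Import all_classical all_reals all_analysis.
Import Order.TTheory GRing.Theory Num.Theory.
Import numFieldNormedType.Exports.

Set Implicit Arguments.
Unset Strict Implicit.
Unset Printing Implicit Defensive.

Local Open Scope classical_set_scope.
Local Open Scope ring_scope.

(* 'Z_n is the integers mod n only for n >= 2, which holds for every m k
   whenever m is bounded_vilenkin. *)
Definition bounded_vilenkin (m : nat -> nat) : Prop :=
  (forall k, (2 <= m k)%N) /\ (exists B, forall k, (m k <= B)%N).

Definition vilenkin_top (m : nat -> nat) : Type :=
  prod_topology (fun k : nat => discrete_topology 'Z_(m k)).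

HB.instance Definition _ m := Topological.copy (vilenkin_top m)
  (prod_topology (fun k : nat => discrete_topology 'Z_(m k))).
HB.instance Definition _ m :=
  isPointed.Build (vilenkin_top m) (fun k => (0 : 'Z_(m k))).

(* G_m with its Borel sigma-algebra *)
Notation vilenkin m := (g_sigma_algebraType (@open (vilenkin_top m))).

Definition vadd (m : nat -> nat) (a x : vilenkin m) : vilenkin m :=
  fun k => (a k : 'Z_(m k)) + x k.

(* The type of [mu] already makes it a Borel measure of total mass 1. *)
Definition normalized_haar (R : realType) (m : nat -> nat)
    (mu : probability (vilenkin m) R) : Prop :=
  forall (a : vilenkin m) (A : set (vilenkin m)), measurable A ->
    mu (vadd a @` A) = mu A.

Definition cylinder (m : nat -> nat) (n : nat) (x : vilenkin m) :
    set (vilenkin m) :=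
  [set y | forall k, (k < n)%N -> y k = x k].

(* F_n is the sigma-algebra generated by this family. *)
Definition cylinders (m : nat -> nat) (n : nat) : set (set (vilenkin m)) :=
  range (cylinder n).
Arguments cylinders : clear implicits.

Definition gen_base (m : nat -> nat) (k : nat) : nat := (\prod_(i < k) m i)%N.

Definition digit (m : nat -> nat) (n j : nat) : nat :=
  ((n %/ gen_base m j) %% m j)%N.

Section digit_facts.
Local Open Scope nat_scope.
Variables (m : nat -> nat).
Hypothesis m_ge2 : forall k, 2 <= m k.

Lemma gen_base0 : gen_base m 0 = 1.
Proof. by rewrite /gen_base big_ord0. Qed.

Lemma gen_baseS k : gen_base m k.+1 = m k * gen_base m k.
Proof. by rewrite /gen_base big_ord_recr mulnC. Qed.

Lemma ltn_gen_base n : n < gen_base m n.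
Proof.
elim: n => [|n IH]; first by rewrite gen_base0.
by rewrite gen_baseS; have := m_ge2 n; nia.
Qed.

Lemma ltn_digit n j : digit m n j < m j.
Proof. by rewrite ltn_mod; apply: leq_trans (m_ge2 j). Qed.

Lemma digit_expansion_mod n k :
  \sum_(j < k) digit m n j * gen_base m j = n %% gen_base m k.
Proof.
elim: k => [|k IH]; first by rewrite big_ord0 gen_base0 modn1.
rewrite big_ord_recr /= IH /digit gen_baseS.
have M0 : 0 < gen_base m k by apply: leq_ltn_trans (ltn_gen_base k).
have mk0 : 0 < m k by apply: leq_trans (m_ge2 k).
set M := gen_base m k in M0 *.
have e1 := divn_eq n M.
have e2 := divn_eq (n %/ M) (m k).
have h1 : n %% M < M by rewrite ltn_mod.
have h2 : (n %/ M) %% m k < m k by rewrite ltn_mod.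
rewrite -/M.
have en : n = (n %/ M %/ m k) * (m k * M) + ((n %/ M) %% m k * M + n %% M).
  by rewrite {1}e1 {1}e2 mulnDl -mulnA addnA.
by rewrite [in RHS]en modnMDl [RHS]modn_small 1?addnC //; nia.
Qed.

Lemma digit_expansion n : \sum_(j < n) digit m n j * gen_base m j = n.
Proof. by rewrite digit_expansion_mod modn_small // ltn_gen_base. Qed.

Lemma digit_ge n j : n <= j -> digit m n j = 0.
Proof.
move=> nj; rewrite /digit divn_small ?mod0n //.
exact: leq_ltn_trans nj (ltn_gen_base j).
Qed.

End digit_facts.

Section vilenkin_fourier.
Variables (R : realType) (m : nat -> nat) (mu : probability (vilenkin m) R).
Local Notation G := (vilenkin m).
Local Notation C := R[i].
Local Open Scope complex_scope.

Definition cexpi (t : R) : C := cos t +i* sin t.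

Definition rademacher (k : nat) (x : G) : C :=
  cexpi (2 * pi * (x k : nat)%:R / (m k)%:R).

(* The factors with k >= n are 1, by digit_ge. *)
Definition psi (n : nat) (x : G) : C :=
  \prod_(k < n) rademacher k x ^+ digit m n k.

Definition cabs (z : C) : R := complex.Re `|z|.

Definition cintegrable (f : G -> C) : Prop :=
  mu.-integrable [set: G] (EFin \o (fun x => complex.Re (f x))) /\
  mu.-integrable [set: G] (EFin \o (fun x => complex.Im (f x))).

Definition cintegral (f : G -> C) : C :=
  (\int[mu]_x complex.Re (f x)) +i* (\int[mu]_x complex.Im (f x)).

Definition fourier (f : G -> C) (n : nat) : C :=
  cintegral (fun x => f x * (psi n x)^*).

Definition partial_sum (c : nat -> C) (n : nat) (x : G) : C :=
  \sum_(k < n) c k * psi k x.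

Definition F_measurable (n : nat) (f : G -> C) : Prop :=
  @measurable_fun _ _ (g_sigma_algebraType (cylinders m n)) R setT
    (fun x => complex.Re (f x)) /\
  @measurable_fun _ _ (g_sigma_algebraType (cylinders m n)) R setT
    (fun x => complex.Im (f x)).

Definition martingale (f : nat -> G -> C) : Prop :=
  [/\ forall n, cintegrable (f n),
      forall n, F_measurable n (f n) &
      forall n l, (n <= l)%N ->
        partial_sum (fourier (f l)) (gen_base m n) = f n].

Definition maximal_function (f : nat -> G -> C) (x : G) : \bar R :=
  ereal_sup (range (fun n => (cabs (f n x))%:E)).

Definition hardy_norm (p : R) (f : nat -> G -> C) : \bar R :=
  'N[mu]_(p%:E)[maximal_function f]%E.

Definition hardy (p : R) (f : nat -> G -> C) : Prop :=
  martingale f /\ (hardy_norm p f < +oo)%E.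

Definition mart_fourier (f : nat -> G -> C) (i : nat) : C :=
  lim ((fun k => fourier (f k) i : C^o) @ \oo).

Definition T_mean (q : nat -> R) (f : nat -> G -> C) (n : nat) (x : G) : C :=
  (\sum_(k < n) q k)^-1%:C *
  \sum_(k < n) (q k)%:C * partial_sum (mart_fourier f) k x.

Definition T_maximal (p : R) (q : nat -> R) (f : nat -> G -> C) (x : G) :
    \bar R :=
  ereal_sup [set (cabs (T_mean q f n x) /
      (n.+1%:R `^ (p^-1 - 2) * ln n.+1%:R ^ (2 * Num.floor (2^-1 + p))))%:E
    | n in [set n | (0 < n)%N]].

(* [A] may take the value +oo: a supremum over n need not be finite everywhere. *)
Definition bounded_Hp_Lp (p : R) (A : (nat -> G -> C) -> G -> \bar R) : Prop :=
  exists c : R, forall f, hardy p f ->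
    ('N[mu]_(p%:E)[A f] <= c%:E * hardy_norm p f)%E.

End vilenkin_fourier.

(* Main.v *)
(* Write P_n = S_0 f + ... + S_{n-1} f.  Abel summation turns T_n f into a
   subconvex combination of the Fejer means P_{j+1} / j with j < n, so it is
   enough to bound |P_{j+1}| by j times the weight of index j.

   For n <= M_l the kernel of P_n at x - y is at most a constant times M_t M_s,
   where t < s are the first two coordinates in which x and y differ (replaced
   by l if there are fewer).  Since f^(l) is constant on the M_l cylinders of
   level l, the embedding of l^p into l^1 over these cylinders gives
     |P_n(x)|^p <= C M_l^(1-p) sum_{t <= s <= l} (M_t M_s)^p E_{s,t}(|f^(l)|^p)(x),
   where E_{s,t} h (x) integrates h over the y that agree with x below s except
   perhaps at t.  No cancellation of f is used, hence no atomic decomposition.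
   With g_l = max_{k <= l} |f^(k)|^p in place of |f^(l)|^p:
   - for p < 1/2 the sum over s, t, integrated in x, is a convergent geometric
     series;
   - for p = 1/2 the logarithms contribute a factor 1/l.  Write g_l as the sum
     of its increments d_k, k <= l, which are nonnegative and constant on
     cylinders of level k.  The terms with s <= k are absorbed by 1/l <= 2/(k+1),
     those with t < k < s decay geometrically in s - t, and those with
     k <= t, k < s are pointwise at most a multiple of d_k(x).
   The sums over cylinders become Haar integrals by monotone convergence. *)

From HB Require Import structures.
From mathcomp Require Import all_boot all_order all_algebra.
From mathcomp Require Import archimedean zify ring lra complex.
From mathcomp Require Import all_classical all_reals all_analysis.
From mathcomp Require Import measurable_realfun.
Require Import Defs.
Import Order.TTheory GRing.Theory Num.Theory.
Import numFieldNormedType.Exports.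

Set Implicit Arguments.
Unset Strict Implicit.
Unset Printing Implicit Defensive.

Local Open Scope classical_set_scope.
Local Open Scope ring_scope.

(** * Digits and kernels *)

Section digits.
Local Open Scope nat_scope.
Variables (m : nat -> nat).
Hypothesis m_ge2 : forall k, 2 <= m k.
Local Notation M := (gen_base m).

Lemma gen_base_gt0 k : 0 < M k.
Proof. exact: leq_ltn_trans (ltn_gen_base m_ge2 k). Qed.

Lemma gen_base_dvd k l : k <= l -> M k %| M l.
Proof.
move=> /subnKC <-; elim: (l - k) => [|d IH]; first by rewrite addn0.
by rewrite addnS gen_baseS; apply: dvdn_mull.
Qed.

Lemma leq_gen_base k l : k <= l -> M k <= M l.
Proof. by move=> kl; apply: dvdn_leq (gen_base_gt0 _) (gen_base_dvd kl). Qed.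

Lemma digit0n k : digit m 0 k = 0.
Proof. by rewrite /digit div0n mod0n. Qed.

Lemma digit_blockl s a b k : k < s -> digit m (a * M s + b) k = digit m b k.
Proof.
move=> ks; rewrite /digit.
have /dvdnP[W ->] := gen_base_dvd ks.
have -> : (a * (W * M k.+1) + b = a * W * m k * M k + b)%N.
  by rewrite gen_baseS !mulnA.
by rewrite divnMDl ?gen_base_gt0 // modnMDl.
Qed.

Lemma digit_blockr s a b k : s <= k -> b < M s ->
  digit m (a * M s + b) k = digit m (a * M s) k.
Proof.
move=> sk bM; rewrite /digit.
have /dvdnP[W ->] := gen_base_dvd sk.
rewrite (mulnC W) !divnMA divnMDl ?gen_base_gt0 // (divn_small bM) addn0.
by rewrite mulnK ?gen_base_gt0.
Qed.

Lemma digit_mull s a k : k < s -> digit m (a * M s) k = 0.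
Proof. by move=> ks; rewrite -(addn0 (a * _)) digit_blockl // digit0n. Qed.

Lemma digit_small k n : n < M k -> digit m n k = 0.
Proof. by move=> nM; rewrite /digit divn_small // mod0n. Qed.

Lemma digit_small_ge l k n : n < M l -> l <= k -> digit m n k = 0.
Proof. by move=> nM lk; apply/digit_small/(leq_trans nM)/leq_gen_base. Qed.

Lemma digit_mulr s e : e < m s -> digit m (e * M s) s = e.
Proof. by move=> em; rewrite /digit mulnK ?gen_base_gt0 // modn_small. Qed.

Lemma ltn_mulM s e : e < m s -> e * M s < M s.+1.
Proof. by move=> em; rewrite gen_baseS ltn_mul2r em gen_base_gt0. Qed.

Lemma block_lt s e b : e < m s -> b < M s -> e * M s + b < M s.+1.
Proof.
by move=> em bM; rewrite gen_baseS; have := leq_mul em (leqnn (M s)); lia.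
Qed.

Lemma digit_inj L x y : x < M L -> y < M L ->
  (forall k, k < L -> digit m x k = digit m y k) -> x = y.
Proof.
move=> xL yL xy; rewrite -(modn_small xL) -(modn_small yL).
rewrite -!(digit_expansion_mod m_ge2); apply: eq_bigr => i _.
by rewrite xy.
Qed.

End digits.

Lemma sum_block (V : nmodType) (F : nat -> V) (A U b : nat) :
  \sum_(j < A * U + b) F j =
  \sum_(i < A) \sum_(j < U) F (i * U + j)%N + \sum_(j < b) F (A * U + j)%N.
Proof.
rewrite big_split_ord /=; congr (_ + _).
elim: A => [|A IH]; first by rewrite mul0n !big_ord0.
by rewrite big_ord_recr /= -IH mulSn addnC big_split_ord.
Qed.

(** * Dirichlet and Fejer kernels as functions of the Rademacher values *)

Section kernel.
Variables (m : nat -> nat) (C : numDomainType).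
Hypothesis m_ge2 : forall k, (2 <= m k)%N.
Local Notation M := (gen_base m).

(* The value of psi_n at a point whose Rademacher values are z_0, z_1, ... *)
Definition chi (z : nat -> C) (n : nat) : C := \prod_(k < n) z k ^+ digit m n k.

Lemma chiE z L n : (n < M L)%N -> chi z n = \prod_(k < L) z k ^+ digit m n k.
Proof.
move=> nL; rewrite /chi; have [nleL|/ltnW Llen] := leqP n L.
  rewrite -(subnKC nleL) big_split_ord /= [X in _ = _ * X]big1 ?mulr1 // => i _.
  by rewrite (digit_ge m_ge2) ?leq_addr ?expr0.
rewrite -(subnKC Llen) big_split_ord /= [X in _ * X = _]big1 ?mulr1 => [|i _].
  by rewrite subnKC.
by rewrite subnKC // (digit_small_ge m_ge2 nL) ?leq_addr ?expr0.
Qed.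

(** The numbers a M_s and b < M_s have their nonzero digits at disjoint positions, from s on and
    below s, so the product splits. *)
Lemma chi_block z s a b : (b < M s)%N ->
  chi z (a * M s + b) = chi z (a * M s) * chi z b.
Proof.
move=> bM; set L := (a * M s + b + s)%N.
have lt1 : (a * M s + b < M L)%N.
  by apply: leq_ltn_trans (ltn_gen_base m_ge2 L); rewrite leq_addr.
rewrite !(chiE z (L := L)) //; last 2 first.
- by apply: leq_ltn_trans lt1; rewrite leq_addl.
- by apply: leq_ltn_trans lt1; rewrite leq_addr.
rewrite -big_split /=; apply: eq_bigr => k _; rewrite -exprD; congr (_ ^+ _).
have [ks|sk] := ltnP k s.
  by rewrite digit_blockl // digit_mull.
by rewrite digit_blockr // [X in (_ + X)%N](digit_small_ge m_ge2 bM) ?addn0.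
Qed.

Lemma chi_pow z s e : (e < m s)%N -> chi z (e * M s) = z s ^+ e.
Proof.
move=> em; rewrite (chiE z (ltn_mulM m_ge2 em)) big_ord_recr /=.
rewrite digit_mulr // big1 ?mul1r // => i _.
by rewrite digit_mull ?expr0.
Qed.

Lemma norm_chi z n : (forall k, `|z k| = 1) -> `|chi z n| = 1.
Proof.
by move=> z1; rewrite normr_prod big1 // => i _; rewrite normrX z1 expr1n.
Qed.

(* M_s / M_r, exact only for r <= s. *)
Definition base_ratio (r s : nat) : nat := M s %/ M r.

Lemma base_ratioK r s : (r <= s)%N -> (base_ratio r s * M r)%N = M s.
Proof. by move=> rs; rewrite divnK // gen_base_dvd. Qed.

Lemma base_ratioS r s : (r <= s)%N -> base_ratio r s.+1 = (m s * base_ratio r s)%N.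
Proof. by move=> rs; rewrite /base_ratio gen_baseS muln_divA // gen_base_dvd. Qed.

(** As a runs over its range, the digit at s takes all its values independently of the lower ones.
    The sum thus contains the factor 1 + z_s + ... + z_s^(m_s - 1), which vanishes for an m_s-th
    root of unity other than 1. *)
Lemma chi_sum0 z r s : (r <= s)%N -> z s ^+ m s = 1 -> z s != 1 ->
  \sum_(a < base_ratio r s.+1) chi z (a * M r) = 0.
Proof.
move=> rs zm z1; rewrite base_ratioS // -[(m s * _)%N]addn0.
rewrite (sum_block (fun a => chi z (a * M r))) big_ord0 addr0.
have E (i : 'I_(m s)) : \sum_(j < base_ratio r s) chi z ((i * base_ratio r s + j) * M r)
    = z s ^+ i * \sum_(j < base_ratio r s) chi z (j * M r).
  rewrite mulr_sumr; apply: eq_bigr => j _.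
  rewrite mulnDl -mulnA base_ratioK // chi_block ?(chi_pow z (ltn_ord i)) //.
  by rewrite -[X in (_ < X)%N](base_ratioK rs) ltn_mul2r gen_base_gt0 //=.
under eq_bigr do rewrite E.
rewrite -mulr_suml.
have /eqP : (z s - 1) * \sum_(i < m s) z s ^+ i = 0 by rewrite -subrX1 zm subrr.
by rewrite mulf_eq0 subr_eq0 (negPf z1) /= => /eqP ->; rewrite mul0r.
Qed.

(** Full blocks cancel by [chi_sum0], so only the incomplete last one survives. The case r = 0
    concerns Dirichlet kernels, the case r = t + 1 the sum over blocks in [fejer_block]. *)
Lemma chi_sum_block z r s a b : (r <= s)%N -> z s ^+ m s = 1 -> z s != 1 ->
  (b <= base_ratio r s.+1)%N ->
  \sum_(j < a * base_ratio r s.+1 + b) chi z (j * M r) =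
  chi z (a * M s.+1) * \sum_(j < b) chi z (j * M r).
Proof.
move=> rs zm z1 bZ; rewrite (sum_block (fun j => chi z (j * M r))) /= big1 ?add0r => [|i _].
  rewrite mulr_sumr; apply: eq_bigr => j _.
  rewrite mulnDl -mulnA base_ratioK ?(leqW rs) // chi_block //.
  rewrite -[X in (_ < X)%N](base_ratioK (leqW rs)) ltn_mul2r gen_base_gt0 //=.
  exact: leq_trans bZ.
transitivity (chi z (i * M s.+1) * \sum_(j < base_ratio r s.+1) chi z (j * M r));
  last by rewrite chi_sum0 ?mulr0.
rewrite mulr_sumr; apply: eq_bigr => j _.
rewrite mulnDl -mulnA base_ratioK ?(leqW rs) // chi_block //.
by rewrite -[X in (_ < X)%N](base_ratioK (leqW rs)) ltn_mul2r gen_base_gt0 //=.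
Qed.

Lemma norm_chi_sum z r n : (forall k, `|z k| = 1) ->
  `|\sum_(j < n) chi z (j * M r)| <= n%:R.
Proof.
move=> z1; apply: le_trans (ler_norm_sum _ _ _) _.
by under eq_bigr do rewrite norm_chi //; rewrite sumr_const card_ord.
Qed.

Lemma norm_chi_sum_le z r s n : (forall k, `|z k| = 1) ->
  (r <= s)%N -> z s ^+ m s = 1 -> z s != 1 ->
  `|\sum_(j < n) chi z (j * M r)| <= (base_ratio r s.+1)%:R.
Proof.
move=> z1 rs zm zn1; rewrite (divn_eq n (base_ratio r s.+1)).
have Z0 : (0 < base_ratio r s.+1)%N.
  by rewrite divn_gt0 ?gen_base_gt0 // leq_gen_base // leqW.
have lt := ltn_pmod n Z0.
rewrite chi_sum_block ?(ltnW lt) // normrM norm_chi // mul1r.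
apply: le_trans (norm_chi_sum _ _ z1) _.
by rewrite ler_nat ltnW.
Qed.

Definition dirichlet z k : C := \sum_(j < k) chi z j.
(** Without the factor 1/n: convolution with it gives the sum P_n, not a mean. *)
Definition fejer z n : C := \sum_(k < n) dirichlet z k.

Lemma dirichlet_chiE z k : dirichlet z k = \sum_(j < k) chi z (j * M 0).
Proof. by apply: eq_bigr => j _; rewrite gen_base0 muln1. Qed.

Lemma base_ratio0 s : base_ratio 0 s = M s.
Proof. by rewrite /base_ratio gen_base0 divn1. Qed.

Lemma dirichlet_block z t a b : z t ^+ m t = 1 -> z t != 1 -> (b <= M t.+1)%N ->
  dirichlet z (a * M t.+1 + b) = chi z (a * M t.+1) * dirichlet z b.
Proof.
move=> zm z1 bM; rewrite !dirichlet_chiE -base_ratio0 chi_sum_block ?base_ratio0 //.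
Qed.

Lemma norm_dirichlet z k : (forall k, `|z k| = 1) -> `|dirichlet z k| <= k%:R.
Proof. by move=> z1; rewrite dirichlet_chiE norm_chi_sum. Qed.

Lemma norm_fejer_triv z n U : (forall k, `|z k| = 1) -> (n <= U)%N ->
  `|fejer z n| <= (n * U)%:R.
Proof.
move=> z1 nU; apply: le_trans (ler_norm_sum _ _ _) _.
apply: (@le_trans _ _ (\sum_(k < n) U%:R)); last first.
  by rewrite sumr_const card_ord mulnC mulrnA.
apply: ler_sum => i _; apply: le_trans (norm_dirichlet _ z1) _.
by rewrite ler_nat (leq_trans _ nU) // ltnW.
Qed.

(** By [dirichlet_block], a nontrivial value at t makes the Dirichlet kernel repeat on blocks of
    length M_(t+1), up to a character value that depends on the block only. *)
Lemma fejer_block z t a b : z t ^+ m t = 1 -> z t != 1 -> (b <= M t.+1)%N ->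
  fejer z (a * M t.+1 + b) =
  (\sum_(i < a) chi z (i * M t.+1)) * fejer z (M t.+1)
  + chi z (a * M t.+1) * fejer z b.
Proof.
move=> zm z1 bM; rewrite /fejer sum_block mulr_suml; congr (_ + _).
  apply: eq_bigr => i _; rewrite mulr_sumr; apply: eq_bigr => j _.
  by rewrite dirichlet_block // ltnW.
rewrite mulr_sumr; apply: eq_bigr => j _.
by rewrite dirichlet_block // ltnW // (leq_trans _ bM).
Qed.

Lemma norm_fejer_one_digit z t n : (forall k, `|z k| = 1) ->
  z t ^+ m t = 1 -> z t != 1 ->
  `|fejer z n| <= `|\sum_(i < n %/ M t.+1) chi z (i * M t.+1)| * (M t.+1 ^ 2)%:R
     + (M t.+1 * n)%:R.
Proof.
move=> z1 zm zn1; have M0 := gen_base_gt0 m_ge2 t.+1.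
have lt := ltn_pmod n M0.
rewrite [in leLHS](divn_eq n (M t.+1)) fejer_block ?(ltnW lt) //.
apply: le_trans (ler_normD _ _) _; rewrite !normrM norm_chi // mul1r.
apply: lerD.
  by rewrite ler_wpM2l // -mulnn norm_fejer_triv.
apply: le_trans (norm_fejer_triv z1 (leq_mod _ _)) _.
by rewrite ler_nat leq_mul2r (ltnW lt) orbT.
Qed.

(** The nontrivial value at s bounds the sum over full blocks by M_(s+1) / M_(t+1), which cancels
    one of the two factors M_(t+1) in the bound for [fejer z (M t.+1)]. *)
Lemma norm_fejer_two_digits z t s n : (forall k, `|z k| = 1) -> (t < s)%N ->
  z t ^+ m t = 1 -> z t != 1 -> z s ^+ m s = 1 -> z s != 1 ->
  `|fejer z n| <= (2 * (M t.+1 * M s.+1))%:R.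
Proof.
move=> z1 ts ztm zt zsm zs; have M0 := gen_base_gt0 m_ge2 t.+1.
have lt := ltn_pmod n M0.
rewrite [in leLHS](divn_eq n (M t.+1)) fejer_block ?(ltnW lt) //.
apply: le_trans (ler_normD _ _) _; rewrite !normrM norm_chi // mul1r.
rewrite mul2n -addnn natrD; apply: lerD.
  apply: le_trans (ler_wpM2l _ (norm_fejer_triv z1 (leqnn _))) _ => //.
  apply: le_trans (ler_wpM2r _ (norm_chi_sum_le _ z1 ts zsm zs)) _ => //.
  rewrite -natrM ler_nat mulnA base_ratioK 1?mulnC //.
  exact: leqW.
apply: le_trans (norm_fejer_triv z1 (ltnW lt)) _.
rewrite ler_nat mulnC leq_mul2l (leq_trans (ltnW lt)) ?orbT //.
by rewrite leq_gen_base // ltnW.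
Qed.

(** With a single nontrivial value at hand, the sum over blocks is estimated by the number of
    blocks. *)
Lemma norm_fejer_one_digit_le z t l n : (forall k, `|z k| = 1) -> (t < l)%N ->
  z t ^+ m t = 1 -> z t != 1 -> (n <= M l)%N ->
  `|fejer z n| <= (2 * (M t.+1 * M l))%:R.
Proof.
move=> z1 tl ztm zt nM; apply: le_trans (norm_fejer_one_digit n z1 ztm zt) _.
apply: le_trans (lerD (ler_wpM2r _ (norm_chi_sum _ _ z1)) (lexx _)) _ => //.
rewrite -natrM -natrD ler_nat mul2n -addnn leq_add //.
  by rewrite -mulnn mulnA mulnC leq_mul // (leq_trans (leq_divM _ _)).
by rewrite leq_mul2l nM orbT.
Qed.

End kernel.

(** * Characters and the two-variable kernel *)

Section rep.
Variables (m : nat -> nat).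
Hypothesis m_ge2 : forall k, (2 <= m k)%N.
Local Notation M := (gen_base m).
Local Notation G := (vilenkin m).

(* The codes y < M_l enumerate the cylinders of level l. *)
Definition rep (y : nat) : G := fun k => inZp (digit m y k) : 'Z_(m k).

Lemma rep_val y k : (rep y k : nat) = digit m y k.
Proof.
rewrite /rep /= modn_small //.
by rewrite Zp_cast ?m_ge2 // ltn_digit.
Qed.

Lemma ltn_coord (x : G) k : (x k < m k)%N.
Proof. by have := ltn_ord (x k); rewrite [X in (_ < X)%N -> _]Zp_cast. Qed.

(** The digits map the codes y < M_L bijectively onto a product of finite sets; the induction splits
    off the leading digit. *)
Lemma sum_prod_digit (C : comPzSemiRingType) L (h : nat -> nat -> C) :
  \sum_(y < M L) \prod_(i < L) h i (digit m y i) =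
  \prod_(i < L) \sum_(a < m i) h i a.
Proof.
elim: L => [|L IH].
  by rewrite gen_base0 big_ord1 !big_ord0.
rewrite gen_baseS -[(m L * _)%N]addn0.
rewrite (sum_block (fun y => \prod_(i < L.+1) h i (digit m y i))).
rewrite big_ord0 addr0 big_ord_recr /= -IH mulrC mulr_suml.
apply: eq_bigr => a _; rewrite mulr_sumr; apply: eq_bigr => b _.
rewrite big_ord_recr /= mulrC digit_blockr // digit_mulr //; congr (_ * _).
by apply: eq_bigr => i _; rewrite digit_blockl.
Qed.

End rep.

Section cabs.
Variable R : realType.
Local Notation C := R[i].
Local Open Scope complex_scope.

Lemma cabsE (z : C) : `|z| = (cabs z)%:C.
Proof. by rewrite /cabs normc_def. Qed.

Lemma cabs_ge0 (z : C) : 0 <= cabs z.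
Proof. by rewrite -lecR -cabsE normr_ge0. Qed.

Lemma cabs_sum (I : Type) (r : seq I) (P : pred I) (F : I -> C) :
  cabs (\sum_(i <- r | P i) F i) <= \sum_(i <- r | P i) cabs (F i).
Proof.
rewrite -lecR -cabsE rmorph_sum /=; apply: le_trans (ler_norm_sum _ _ _) _.
by apply: ler_sum => i _; rewrite cabsE.
Qed.

Lemma cabsM (z w : C) : cabs (z * w) = cabs z * cabs w.
Proof. by apply: complexI; rewrite -cabsE rmorphM /= -!cabsE normrM. Qed.

Lemma cabs_real (r : R) : 0 <= r -> cabs r%:C = r.
Proof. by move=> r0; apply: complexI; rewrite -cabsE ger0_norm ?ler0c. Qed.

Lemma natr_complex (n : nat) : (n%:R : C) = (n%:R : R)%:C.
Proof. by rewrite rmorph_nat. Qed.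

Lemma cexpiD (a b : R) : cexpi (a + b) = cexpi a * cexpi b.
Proof. by rewrite /cexpi cosD sinD /=; congr (_ +i* _); rewrite addrC. Qed.

Lemma cexpi0 : cexpi 0 = 1 :> C.
Proof. by rewrite /cexpi cos0 sin0. Qed.

Lemma cexpiX (a : R) n : cexpi a ^+ n = cexpi (a *+ n).
Proof.
elim: n => [|n IH]; first by rewrite expr0 mulr0n cexpi0.
by rewrite exprS IH mulrS cexpiD.
Qed.

Lemma cexpi2pi n : cexpi (2 * pi *+ n) = 1 :> C.
Proof.
rewrite -cexpiX -[2 * pi]/(2%:R * pi) mulr_natl /cexpi cos2pi sin2pi.
by rewrite -[_ +i* _]/(1 : C) expr1n.
Qed.

Lemma cexpiJ (a : R) : Num.conj (cexpi a) = cexpi (- a).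
Proof. by rewrite [LHS]/(conjc _) /cexpi cosN sinN. Qed.

Lemma norm_cexpi (a : R) : `|cexpi a| = 1.
Proof. by rewrite normc_def /= cos2Dsin2 sqrtr1. Qed.

(** Half the angle lies strictly between 0 and pi, so its sine is positive and the cosine of the
    full angle, 1 - 2 sin^2, is below 1. *)
Lemma cexpi_neq1 (m d : nat) : (0 < d < m)%N ->
  cexpi (2 * pi * d%:R / m%:R : R) != 1.
Proof.
move=> /andP[d0 dm]; apply/negP => /eqP [] + _.
have m0 : (0 : R) < m%:R by rewrite ltr0n (ltn_trans d0).
set a : R := pi * d%:R / m%:R.
have -> : 2 * pi * d%:R / m%:R = a *+ 2 by rewrite /a; ring.
have a0 : 0 < sin a.
  apply: sin_gt0_pi; rewrite /a divr_gt0 ?mulr_gt0 ?pi_gt0 ?(ltr0n _ d) //=.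
  by rewrite ltr_pdivrMr // ltr_pM2l ?pi_gt0 // ltr_nat.
rewrite cos_mulr2n cos2sin2 => E.
move: (sin a) a0 E => s s0 E.
nra.
Qed.

End cabs.

Section characters.
Variables (R : realType) (m : nat -> nat).
Hypothesis m_ge2 : forall k, (2 <= m k)%N.
Local Notation M := (gen_base m).
Local Notation G := (vilenkin m).
Local Notation C := R[i].
Local Open Scope complex_scope.
Local Notation rademacher := (@rademacher R m).
Local Notation psi := (@psi R m).

Lemma natr_modulus_gt0 k : (0 : R) < (m k)%:R.
Proof. by rewrite ltr0n (leq_trans _ (m_ge2 k)). Qed.

(* Rademacher values of x - y, so that chi evaluates psi_n(x - y). *)
Definition char_diff (x y : G) (k : nat) : C := rademacher k x * (rademacher k y)^*.

Lemma char_diffE x y k :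
  char_diff x y k = cexpi (2 * pi * ((x k : nat)%:R - (y k : nat)%:R) / (m k)%:R).
Proof.
rewrite /char_diff /Defs.rademacher cexpiJ -cexpiD; congr cexpi.
by rewrite mulrBr mulrBl.
Qed.

Lemma norm_char_diff x y k : `|char_diff x y k| = 1.
Proof. by rewrite char_diffE norm_cexpi. Qed.

Lemma rademacherX x k : rademacher k x ^+ m k = 1.
Proof.
rewrite /Defs.rademacher cexpiX -[X in cexpi X]mulr_natr divfK ?gt_eqF ?natr_modulus_gt0 //.
by rewrite mulr_natr cexpi2pi.
Qed.

Lemma char_diffX x y k : char_diff x y k ^+ m k = 1.
Proof. by rewrite /char_diff exprMn -rmorphXn /= !rademacherX conjC1 mulr1. Qed.

Lemma char_diff_neq1 x y k : x k <> y k -> char_diff x y k != 1.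
Proof.
(* Exchanging x and y conjugates the value, and a conjugate equals 1 only if the value does. *)
wlog xy : x y / (x k < y k)%N.
  move=> W ne; have : (x k : nat) <> y k by move=> /val_inj.
  move/eqP; rewrite neq_ltn => /orP[|] h; first exact: W.
  have := W y x h (nesym ne); apply: contra => /eqP E.
  rewrite -(conjCK (char_diff y x k)) -conjC1; apply/eqP; congr _^*.
  by rewrite /char_diff rmorphM /= conjCK mulrC.
move=> _; rewrite char_diffE -opprB -natrB ?(ltnW xy) // mulrN mulNr -cexpiJ.
rewrite -[X in _ != X]conjC1 (inj_eq (can_inj (@conjCK _))) cexpi_neq1 //.
by rewrite subn_gt0 xy /= (leq_ltn_trans (leq_subr _ _)) ?ltn_coord.
Qed.

Lemma chi_char_diff x y n : chi m (char_diff x y) n = psi n x * (psi n y)^*.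
Proof.
rewrite /chi /Defs.psi rmorph_prod -big_split /=; apply: eq_bigr => k _.
by rewrite exprMn rmorphXn.
Qed.

Lemma fejer_char_diff x y n :
  fejer m (char_diff x y) n = \sum_(k < n) \sum_(j < k) psi j x * (psi j y)^*.
Proof.
by apply: eq_bigr => k _; apply: eq_bigr => j _; rewrite chi_char_diff.
Qed.

Lemma psi_rep_prod n L y : (n < M L)%N ->
  psi n (rep m y) = \prod_(k < L)
    cexpi (2 * pi * (digit m y k)%:R / (m k)%:R) ^+ digit m n k.
Proof.
move=> nL; rewrite [LHS](chiE m_ge2 (fun k => rademacher k (rep m y)) nL).
by apply: eq_bigr => k _; rewrite /Defs.rademacher rep_val.
Qed.

Lemma sum_root_unity k i j : (i < m k)%N -> (j < m k)%N ->
  \sum_(a < m k) cexpi (2 * pi * a%:R / (m k)%:R) ^+ i *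
     (cexpi (2 * pi * a%:R / (m k)%:R) ^+ j)^* = (m k * (i == j))%:R :> C.
Proof.
move=> im jm.
pose w : C := cexpi (2 * pi * i%:R / (m k)%:R) *
              (cexpi (2 * pi * j%:R / (m k)%:R))^*.
transitivity (\sum_(a < m k) w ^+ a).
  have swap (a l : nat) : 2 * pi * a%:R / (m k)%:R *+ l =
                          2 * pi * l%:R / (m k)%:R *+ a :> R.
    by rewrite -[LHS]mulr_natr -[RHS]mulr_natr; ring.
  apply: eq_bigr => a _; rewrite /w !cexpiX !cexpiJ -!cexpiD cexpiX mulrnDl.
  by rewrite mulNrn !(swap _ a).
have [ij|ij] := eqVneq i j; last first.
  rewrite muln0 mulr0n.
  (* Points with k-th coordinates i and j are made up so that [char_diff_neq1] applies to w. *)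
  pose xx (n : nat) : G := fun l => inZp n : 'Z_(m l).
  have xxE n : (n < m k)%N -> (xx n k : nat) = n.
    by move=> nm; rewrite /xx /= modn_small // Zp_cast.
  have wE : w = char_diff (xx i) (xx j) k.
    by rewrite /w /char_diff /Defs.rademacher !xxE.
  have w1 : w != 1.
    rewrite wE; apply: char_diff_neq1 => E.
    by move/eqP: ij; apply; rewrite -(xxE _ im) -(xxE _ jm) E.
  have /eqP : (w - 1) * \sum_(a < m k) w ^+ a = 0.
    by rewrite -subrX1 wE char_diffX subrr.
  by rewrite mulf_eq0 subr_eq0 (negPf w1) => /eqP.
have -> : w = 1 by rewrite /w ij cexpiJ -cexpiD subrr cexpi0.
under eq_bigr do rewrite expr1n.
by rewrite sumr_const card_ord muln1.
Qed.

(** The sum factors over the digits by [sum_prod_digit]. Distinct indices below M_L differ in some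
    digit below L, and that factor vanishes by [sum_root_unity]. *)
Lemma psi_orthogonal L i j : (i < M L)%N -> (j < M L)%N ->
  \sum_(y < M L) psi i (rep m y) * (psi j (rep m y))^* = (M L * (i == j))%:R.
Proof.
move=> iL jL.
pose h k a : C := cexpi (2 * pi * a%:R / (m k)%:R) ^+ digit m i k *
     (cexpi (2 * pi * a%:R / (m k)%:R) ^+ digit m j k)^*.
transitivity (\sum_(y < M L) \prod_(k < L) h k (digit m y k)).
  apply: eq_bigr => y _; rewrite !(psi_rep_prod _ iL, psi_rep_prod _ jL).
  by rewrite rmorph_prod -big_split.
rewrite sum_prod_digit // /h.
under eq_bigr do rewrite sum_root_unity ?ltn_digit //.
have [<-|/eqP ij] := eqVneq i j.
  by under eq_bigr do rewrite eqxx muln1; rewrite muln1 -natr_prod.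
rewrite muln0; have [k kL] : exists2 k : 'I_L, true & digit m i k != digit m j k.
  apply: contrapT => H; apply: ij; apply: (digit_inj m_ge2 iL jL) => k kL.
  apply/eqP; apply/negPn/negP => E; apply: H.
  by exists (Ordinal kL).
by move=> E; rewrite (bigD1 k) //= (negPf E) muln0 mul0r.
Qed.

(** Discrete Fourier inversion: coefficients are recovered from the values at the codes. *)
Lemma coef_of_sum L (c : nat -> C) j : (j < M L)%N ->
  \sum_(y < M L) partial_sum c (M L) (rep m y) * (psi j (rep m y))^* =
  (M L)%:R * c j.
Proof.
move=> jL; rewrite /partial_sum.
under eq_bigr do rewrite mulr_suml.
rewrite exchange_big /=.
under eq_bigr => i _ do under eq_bigr => y _ do rewrite -mulrA.
under eq_bigr => i _ do rewrite -mulr_sumr psi_orthogonal //.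
rewrite (bigD1 (Ordinal jL)) //= eqxx muln1 big1 ?addr0 1?mulrC // => i ne.
by rewrite -(inj_eq val_inj) /= in ne; rewrite (negPf ne) muln0 mulr0.
Qed.

(** P_n as a discrete convolution with the Fejer kernel. By n <= M_L, [coef_of_sum] applies to every
    index that occurs in P_n. *)
Lemma sum_partial_sum L (c : nat -> C) n x : (n <= M L)%N ->
  (M L)%:R * \sum_(k < n) partial_sum c k x =
  \sum_(y < M L) partial_sum c (M L) (rep m y) * fejer m (char_diff x (rep m y)) n.
Proof.
move=> nL.
under [RHS]eq_bigr do rewrite fejer_char_diff mulr_sumr.
rewrite [RHS]exchange_big [LHS]mulr_sumr /=; apply: eq_bigr => k _.
under [RHS]eq_bigr do rewrite mulr_sumr.
rewrite [RHS]exchange_big /= [X in _ * X = _]/partial_sum [LHS]mulr_sumr.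
apply: eq_bigr => j _.
have jL : (j < M L)%N.
  exact: leq_trans (ltn_trans (ltn_ord j) (ltn_ord k)) nL.
transitivity (psi j x * ((M L)%:R * c j)); first by rewrite mulrA [LHS]mulrC.
rewrite -(coef_of_sum c jL) mulr_sumr; apply: eq_bigr => y _.
by rewrite mulrCA.
Qed.

(** For t >= s the exception is void, and the relation says that x and y share a cylinder of level
    s. *)
Definition nbr (s t : nat) (x y : G) : bool :=
  [forall i : 'I_s, ((i : nat) != t) ==> (x i == y i)].

Lemma nbrP s t x y :
  reflect (forall i, (i < s)%N -> i != t -> x i = y i) (nbr s t x y).
Proof.
apply: (iffP forallP) => [H i iS it|H i].
  by have /implyP/(_ it)/eqP := H (Ordinal iS).
by apply/implyP => it; apply/eqP/H.
Qed.

(** Three cases for the coordinates below l where x and y differ: none (s = t = l, trivial bound),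
    only t (s = l, one-digit bound), or at least two (t < s the first two of them). Replacing
    M_(k+1) by B M_k costs the factor B^2. *)
Lemma fejer_kernel_bound B l n x y : (forall k, (m k <= B)%N) -> (n <= M l)%N ->
  exists s t, [/\ (t <= s)%N, (s <= l)%N, nbr s t x y &
    `|fejer m (char_diff x y) n| <= (2 * B ^ 2 * (M t * M s))%:R].
Proof.
move=> mB nM; have z1 := norm_char_diff x y.
have B2 : (2 <= B)%N by apply: leq_trans (mB 0%N).
have MB k : (M k.+1 <= B * M k)%N by rewrite gen_baseS leq_mul2r mB orbT.
pose P t := (t < l)%N && (x t != y t).
have [/existsP[t0 /negPf tP]|] := boolP [exists t : 'I_l, x t != y t]; last first.
  rewrite negb_exists => /forallP H; exists l, l; split => //.
    by apply/nbrP => i il _; apply/eqP; have := H (Ordinal il); rewrite negbK.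
  apply: le_trans (norm_fejer_triv m z1 nM) _.
  rewrite ler_nat; apply: leq_trans (leq_mul nM (leqnn _)) _.
  by rewrite leq_pmull // muln_gt0 expn_gt0 (ltnW B2).
have ex1 : exists t, P t by exists t0; rewrite /P ltn_ord tP.
case: (ex_minnP ex1) => t /andP[tl xt] tmin.
have xyt i : (i < t)%N -> x i = y i.
  move=> it; apply/eqP/negPn/negP => E; have := tmin i.
  by rewrite /P (ltn_trans it tl) E leqNgt it => /(_ isT).
have zt := char_diff_neq1 (elimN eqP xt).
pose Q s := [&& (t < s)%N, (s < l)%N & x s != y s].
have [/existsP[s0 sP]|] := boolP [exists s : 'I_l, Q s]; last first.
  rewrite negb_exists => /forallP H; exists l, t; split => //; first exact: ltnW.
    apply/nbrP => i il it; have [|ti] := ltnP i t; first exact: xyt.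
    apply/eqP/negPn/negP => E; have := H (Ordinal il); rewrite /Q /= il E.
    by rewrite !andbT ltn_neqAle eq_sym it ti.
  apply: le_trans (norm_fejer_one_digit_le m_ge2 z1 tl (char_diffX x y t) zt nM) _.
  rewrite ler_nat -mulnA leq_mul2l /= mulnA leq_mul2r; apply/orP; right.
  by apply: leq_trans (MB t) _; rewrite leq_mul2r leq_pmulr ?orbT // (ltnW B2).
have ex2 : exists s, Q s by exists s0.
case: (ex_minnP ex2) => s /and3P[ts sl xs] smin.
exists s, t; split => //; [exact: ltnW | exact: ltnW | |].
  apply/nbrP => i il it; have [|ti] := ltnP i t; first exact: xyt.
  apply/eqP/negPn/negP => E; have := smin i.
  rewrite /Q E (ltn_trans il sl) ltn_neqAle eq_sym it ti leqNgt il.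
  by move=> /(_ isT).
have zs := char_diff_neq1 (elimN eqP xs).
apply: le_trans (norm_fejer_two_digits m_ge2 n z1 ts (char_diffX x y t) zt (char_diffX x y s) zs) _.
rewrite ler_nat -!mulnA leq_mul2l /=; apply: leq_trans (leq_mul (MB t) (MB s)) _.
by rewrite mulnACA -mulnA leqnn.
Qed.

Lemma cabs_sum_partial_sum B l n (c : nat -> C) x :
  (forall k, (m k <= B)%N) -> (n <= M l)%N ->
  (M l)%:R * cabs (\sum_(k < n) partial_sum c k x) <=
  \sum_(y < M l) cabs (partial_sum c (M l) (rep m y)) *
    \sum_(s < l.+1) \sum_(t < s.+1)
      (nbr s t x (rep m y))%:R * (2 * B ^ 2 * (M t * M s))%:R :> R.
Proof.
move=> mB nM.
rewrite -[X in X * _]cabs_real ?ler0n // -cabsM -natr_complex sum_partial_sum //.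
apply: le_trans (cabs_sum _ _ _) _; apply: ler_sum => y _.
rewrite cabsM ler_wpM2l ?cabs_ge0 //.
have [s [t [ts sl xy]]] := fejer_kernel_bound x (rep m y) mB nM.
rewrite cabsE natr_complex lecR => H.
(* The pair (s, t) depends on y. All terms being nonnegative, the sum over all pairs dominates the
   one selected here. *)
rewrite (bigD1 (Ordinal (sl : s < l.+1)%N)) //=.
rewrite (bigD1 (Ordinal (ts : t < s.+1)%N)) //= xy mul1r -addrA.
apply: le_trans H _; rewrite lerDl.
by apply: addr_ge0; rewrite ?sumr_ge0 // => i _; rewrite ?sumr_ge0 // => j _;
   rewrite mulr_ge0.
Qed.

End characters.

(** * The maximal inequality on finite levels *)

Section geometric.
Variables (R : realFieldType) (r : R).
Hypotheses (r0 : 0 < r) (r1 : r < 1).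
Local Notation D := (1 - r)^-1.

Lemma geo_D_gt0 : 0 < D.
Proof. by rewrite invr_gt0 subr_gt0. Qed.

Lemma geo_tail k n : \sum_(i < n) (k <= i)%:R * r ^+ (i - k) <= D.
Proof.
(* The induction needs the missing tail r^(n - k); for n <= k the truncated difference makes the
   bound 0. *)
suff : \sum_(i < n) (k <= i)%:R * r ^+ (i - k) <= D * (1 - r ^+ (n - k)).
  move=> /le_trans; apply; rewrite ler_piMr ?(ltW geo_D_gt0) //.
  by rewrite gerBl exprn_ge0 // ltW.
elim: n => [|n IH]; first by rewrite big_ord0 sub0n expr0 subrr mulr0.
rewrite big_ord_recr /=; apply: le_trans (lerD IH (lexx _)) _.
have [kn|nk] := leqP k n.
  rewrite mul1r subSn // exprS.
  have D1 : D * (1 - r) = 1 by rewrite mulVf // gt_eqF // subr_gt0.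
  move: (r ^+ _) => x.
  have -> : D * (1 - r * x) = D * (1 - x) + D * (1 - r) * x by ring.
  by rewrite D1 mul1r.
rewrite mul0r addr0; have /eqP -> : (n.+1 - k == 0)%N by rewrite subn_eq0.
by have /eqP -> : (n - k == 0)%N by rewrite subn_eq0 ltnW.
Qed.

Lemma geo_head k n : \sum_(i < n) (i <= k)%:R * r ^+ (k - i) <= D.
Proof.
have D0 := geo_D_gt0.
(* Here the sum is compared with its last nonzero term, r^(k + 1 - n) for 0 < n <= k; afterwards the
   exponent stays 0. *)
suff : \sum_(i < n) (i <= k)%:R * r ^+ (k - i) <= D * r ^+ (k.+1 - n).
  move=> /le_trans; apply; rewrite ler_piMr ?(ltW geo_D_gt0) //.
  by rewrite exprn_ile1 // ltW.
elim: n => [|n IH]; first by rewrite big_ord0 mulr_ge0 ?exprn_ge0 ?ltW.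
rewrite big_ord_recr /=; apply: le_trans (lerD IH (lexx _)) _.
have [nk|kn] := leqP n k.
  rewrite mul1r subSn // subSS exprS.
  have D1 : D * (1 - r) = 1 by rewrite mulVf // gt_eqF // subr_gt0.
  move: (r ^+ _) => x.
  have -> : D * x = D * (r * x) + D * (1 - r) * x by ring.
  by rewrite D1 mul1r.
rewrite mul0r addr0 ler_wpM2l ?(ltW D0) // subSS.
have /eqP -> : (k.+1 - n == 0)%N by rewrite subn_eq0.
by have /eqP -> : (k - n == 0)%N by rewrite subn_eq0 ltnW.
Qed.

End geometric.

Lemma sum_block0 (V : nmodType) (F : nat -> V) (A U : nat) :
  \sum_(j < A * U) F j = \sum_(i < A) \sum_(j < U) F (i * U + j)%N.
Proof. by have := sum_block F A U 0; rewrite addn0 big_ord0 addr0. Qed.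

(** * Averages over the cylinders of a finite level *)

Section averages.
Variables (R : realType) (m : nat -> nat).
Hypothesis m_ge2 : forall k, (2 <= m k)%N.
Local Notation M := (gen_base m).
Local Notation G := (vilenkin m).

(** The Haar integral of a function constant on cylinders of level L, as [integral_level] shows for
    nonnegative ones. *)
Definition avg (L : nat) (h : G -> R) : R :=
  (M L)%:R^-1 * \sum_(y < M L) h (rep m y).

Definition level_fun (T : Type) (l : nat) (h : G -> T) :=
  forall x y, (forall i, (i < l)%N -> x i = y i) -> h x = h y.

Lemma natr_gen_base_gt0 l : (0 : R) < (M l)%:R.
Proof. by rewrite ltr0n gen_base_gt0. Qed.

Lemma avg_level l L h : (l <= L)%N -> level_fun l h -> avg L h = avg l h.
Proof.
move=> lL hl; rewrite /avg -(base_ratioK m lL); set Z := base_ratio m l L.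
have Z0 : (Z%:R : R) != 0.
  by rewrite pnatr_eq0 -lt0n divn_gt0 ?gen_base_gt0 // leq_gen_base.
rewrite (sum_block0 (fun y => h (rep m y))).
have E (i : 'I_Z) : \sum_(j < M l) h (rep m (i * M l + j)%N) =
    \sum_(j < M l) h (rep m j).
  apply: eq_bigr => j _; apply: hl => k kl; apply: ord_inj.
  by rewrite !rep_val // digit_blockl.
under eq_bigr do rewrite E.
rewrite sumr_const card_ord -[X in _ * X]mulr_natl mulrA natrM invfM.
by rewrite [X in X * _]mulrAC mulVf ?mul1r.
Qed.

Lemma avg_ge0 L h : (forall x, 0 <= h x) -> 0 <= avg L h.
Proof. by move=> h0; rewrite mulr_ge0 ?invr_ge0 ?sumr_ge0. Qed.

Lemma ler_avg L g h : (forall x, g x <= h x) -> avg L g <= avg L h.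
Proof. by move=> gh; rewrite ler_wpM2l ?invr_ge0 ?ler_sum. Qed.

Lemma avgD L g h : avg L (fun x => g x + h x) = avg L g + avg L h.
Proof. by rewrite /avg big_split mulrDr. Qed.

Lemma avgZ L a h : avg L (fun x => a * h x) = a * avg L h.
Proof. by rewrite /avg -mulr_sumr mulrCA. Qed.

Lemma avg_sum L (I : Type) (s : seq I) (P : pred I) (h : I -> G -> R) :
  avg L (fun x => \sum_(i <- s | P i) h i x) = \sum_(i <- s | P i) avg L (h i).
Proof. by rewrite /avg exchange_big /= mulr_sumr. Qed.

Lemma nbr_sym s t (x y : G) : nbr s t x y = nbr s t y x.
Proof. by apply: eq_forallb => i; rewrite (eq_sym (x i)). Qed.

Lemma nbr_prod s t L (x : nat) (y : G) : (s <= L)%N ->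
  (nbr s t (rep m x) y)%:R =
  \prod_(i < L) (((i < s)%N && (i != t :> nat)) ==> (digit m x i == y i))%:R :> R.
Proof.
move=> sL; case: (boolP (nbr _ _ _ _)) => [/nbrP H|].
  rewrite big1 // => i _; rewrite (_ : _ ==> _) //.
  by apply/implyP => /andP[/H{}H /H <-]; rewrite rep_val.
rewrite negb_forall => /existsP[j]; rewrite negb_imply => /andP[jt ne].
rewrite (bigD1 (widen_ord sL j)) //= ltn_ord jt /=.
rewrite (_ : (_ == _) = false) ?mul0r //; apply: contraNF ne => /eqP E.
by apply/eqP/ord_inj; rewrite rep_val // E.
Qed.

(** The share of such x is 1 / M_s, times m_t <= B if the coordinate t < s is left free. *)
Lemma avg_nbr B s t L (y : G) : (forall k, (m k <= B)%N) -> (s <= L)%N ->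
  avg L (fun x => (nbr s t x y)%:R) <= B%:R / (M s)%:R.
Proof.
move=> mB sL; rewrite /avg.
under eq_bigr do rewrite (nbr_prod _ _ _ sL).
rewrite (sum_prod_digit m_ge2 L (fun i a =>
  ((((i < s)%N && (i != t)) ==> (a == y i))%:R : R))).
(* The number of admissible digits at i: one where y prescribes it, m_i where it is free. *)
pose c i := if (i < s)%N && (i != t) then 1%N else m i.
have E i : \sum_(a < m i)
    ((((i < s)%N && (i != t)) ==> ((a : nat) == y i))%:R : R) = (c i)%:R.
  rewrite /c; case: ifP => _ /=; last by rewrite sumr_const card_ord.
  rewrite (bigD1 (Ordinal (ltn_coord m_ge2 y i))) //= eqxx big1 ?addr0 // => a ne.
  rewrite (_ : (_ == _) = false) //.
  by apply: contraNF ne => /eqP E; apply/eqP/val_inj.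
under eq_bigr do rewrite E.
rewrite -natr_prod ler_pdivlMr ?natr_gen_base_gt0 // mulrAC -mulrA ler_pdivrMl ?natr_gen_base_gt0 //.
rewrite -!natrM ler_nat.
have -> : M s = (\prod_(i < L) if (i < s)%N then m i else 1)%N.
  rewrite -big_mkcond /gen_base (big_ord_widen L (fun i => m i)) //.
apply: (@leq_trans (\prod_(i < L) (m i * if i == t :> nat then m i else 1))%N).
  rewrite -big_split; apply: leq_prod => i _; rewrite /c.
  by case: (i < s)%N; case: eqP => /=; rewrite ?muln1 ?mul1n ?leq_pmulr //;
     rewrite (leq_trans _ (m_ge2 i)).
rewrite big_split /= leq_mul2l; apply/orP; right.
rewrite -big_mkcond; have [tL|Lt] := ltnP t L.
  by rewrite (big_pred1 (Ordinal tL)).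
rewrite big_pred0 ?(leq_trans _ (mB 0%N)) ?(leq_trans _ (m_ge2 0)) // => i.
by apply/negbTE; rewrite neq_ltn (leq_trans (ltn_ord i) Lt).
Qed.

Variable B : nat.
Hypothesis mB : forall k, (m k <= B)%N.

(** The operator E_{s,t} of the overview, computed at level L. *)
Definition navg (L s t : nat) (h : G -> R) (x : G) : R :=
  avg L (fun y => (nbr s t x y)%:R * h y).

Lemma navg_ge0 L s t h x : (forall y, 0 <= h y) -> 0 <= navg L s t h x.
Proof. by move=> h0; apply: avg_ge0 => y; rewrite mulr_ge0. Qed.

Lemma ler_navg L s t g h x :
  (forall y, g y <= h y) -> navg L s t g x <= navg L s t h x.
Proof. by move=> gh; apply: ler_avg => y; rewrite ler_wpM2l. Qed.

(** After exchanging the sums, the average over x with y fixed is the one bounded by [avg_nbr]. *)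
Lemma avg_navg L s t h : (s <= L)%N -> (forall y, 0 <= h y) ->
  avg L (navg L s t h) <= B%:R / (M s)%:R * avg L h.
Proof.
move=> sL h0; rewrite -avgZ /navg {1 2 3}/avg.
have -> : \sum_(x < M L) (M L)%:R^-1 * \sum_(y < M L)
   (nbr s t (rep m x) (rep m y))%:R * h (rep m y) =
   \sum_(y < M L) avg L (fun x => (nbr s t x (rep m y))%:R) * h (rep m y).
  rewrite -mulr_sumr exchange_big mulr_sumr; apply: eq_bigr => y _.
  by rewrite -mulr_suml mulrA.
rewrite ler_wpM2l ?invr_ge0 // ler_sum // => y _.
by rewrite ler_wpM2r // avg_nbr.
Qed.

(** The only coordinate below s allowed to change is t >= k, so h keeps the value h(x) on the whole
    neighbourhood and leaves the average. *)
Lemma navg_level L s t k h x : (s <= L)%N -> (t <= s)%N -> (k <= t)%N ->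
  (forall y, 0 <= h y) -> level_fun k h -> navg L s t h x <= B%:R / (M s)%:R * h x.
Proof.
move=> sL ts kt h0 hk.
apply: le_trans (_ : h x * avg L (fun y => (nbr s t y x)%:R) <= _); last first.
  by rewrite mulrC ler_wpM2r // avg_nbr.
rewrite -avgZ; apply: ler_avg => y; rewrite mulrC nbr_sym.
case: (boolP (nbr s t y x)) => [/nbrP H|]; last by rewrite !mulr0.
rewrite !mulr1 (hk y x) // => i ik; apply: H.
  exact: leq_trans ik (leq_trans kt ts).
by rewrite ltn_eqF // (leq_trans ik).
Qed.

End averages.

(** * Geometric decay of the weights (M_t M_s)^p *)

Section weights.
Variables (R : realType) (m : nat -> nat) (p : R).
Hypothesis m_ge2 : forall k, (2 <= m k)%N.
Hypotheses (p0 : 0 < p) (p12 : p <= 2^-1).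
Local Notation M := (gen_base m).

Lemma gen_base_exp2 s t : (t <= s)%N -> (M t * 2 ^ (s - t) <= M s)%N.
Proof.
move=> /subnKC <-; rewrite addKn; elim: (s - t)%N => [|d IH].
  by rewrite muln1 addn0.
by rewrite addnS gen_baseS expnSr mulnA mulnC leq_mul.
Qed.

Definition weight (s t : nat) : R := (M t * M s)%:R `^ p.

(* A weight divided by M_s, the inverse measure of a neighbourhood of level s,
   is at most rho^(s-t) sigma^s (weight_le); sigma = 1 exactly for p = 1/2. *)
Definition rho : R := 2 `^ (- p).
Definition sigma : R := 2 `^ (2 * p - 1).

Lemma rho_gt0 : 0 < rho. Proof. exact: powR_gt0. Qed.
Lemma sigma_gt0 : 0 < sigma. Proof. exact: powR_gt0. Qed.

Lemma rho_lt1 : rho < 1.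
Proof.
rewrite /rho powRN invf_lt1 ?powR_gt0 //.
have : 1 `^ p < 2 `^ p :> R by rewrite gt0_ltr_powR ?nnegrE // ltr1n.
by rewrite powR1.
Qed.

Lemma sigma_lt1 : p < 2^-1 -> sigma < 1.
Proof.
move=> p2; rewrite /sigma -[2 * p - 1]opprB powRN invf_lt1 ?powR_gt0 //.
have q0 : 0 < 1 - 2 * p by lra.
have : 1 `^ (1 - 2 * p) < 2 `^ (1 - 2 * p) :> R.
  by rewrite gt0_ltr_powR ?nnegrE // ltr1n.
by rewrite powR1.
Qed.

Lemma weight_ge0 s t : 0 <= weight s t.
Proof. exact: powR_ge0. Qed.

(** The left side equals (M_t / M_s)^p M_s^(2p - 1); then M_t / M_s <= 2^(t - s), M_s >= 2^s and 2p
    - 1 <= 0. *)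
Lemma weight_le s t : (t <= s)%N ->
  weight s t / (M s)%:R <= rho ^+ (s - t) * sigma ^+ s.
Proof.
move=> ts; set a : R := (M t)%:R; set b : R := (M s)%:R.
have a0 : 0 < a by rewrite ltr0n gen_base_gt0.
have b0 : 0 < b by rewrite ltr0n gen_base_gt0.
have -> : weight s t / (M s)%:R = (a / b) `^ p * b `^ (2 * p - 1).
  have bn0 : b != 0 by rewrite gt_eqF.
  have -> : b `^ (2 * p - 1) = b `^ p * b `^ p / b.
    by rewrite powRB ?bn0 ?implybT // powRr1 ?ltW // mulr_natl mulr2n powRD ?bn0 ?implybT.
  rewrite /weight natrM -/a -/b !powRM ?ltW ?invr_gt0 //.
  have -> : b^-1 `^ p = (b `^ p)^-1.
    by rewrite -[b^-1]powR_inv1 ?ltW // -powRrM mulN1r powRN.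
  by field; rewrite bn0 gt_eqF // powR_gt0.
apply: ler_pM; rewrite ?powR_ge0 //.
  rewrite /rho -powR_mulrn ?powR_ge0 // -powRrM mulNr [p * _]mulrC -mulNr powRrM.
  rewrite ge0_ler_powR ?nnegrE ?divr_ge0 ?powR_ge0 ?(ltW p0) ?(ltW a0) ?(ltW b0) //.
  rewrite powR_invn // ler_pdivrMr // mulrC ler_pdivlMr ?exprn_gt0 //.
  by rewrite -natrX -natrM ler_nat gen_base_exp2.
rewrite /sigma -powR_mulrn ?powR_ge0 // -powRrM -[2 * p - 1]opprB.
rewrite mulNr !powRN lef_pV2 ?posrE ?powR_gt0 // mulrC powRrM.
rewrite ge0_ler_powR ?nnegrE ?powR_ge0 ?(ltW b0) //; first
  by rewrite subr_ge0 mulrC -ler_pdivlMr ?mul1r.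
rewrite powR_mulrn // -natrX ler_nat.
by have := gen_base_exp2 (leq0n s); rewrite gen_base0 mul1n subn0.
Qed.

End weights.

Lemma sum_leq_le (R : numDomainType) (n k : nat) :
  \sum_(s < n) (s <= k)%N%:R <= k.+1%:R :> R.
Proof.
suff -> : \sum_(s < n) (s <= k)%N%:R = (minn n k.+1)%:R :> R.
  by rewrite ler_nat geq_minr.
elim: n => [|n IH]; first by rewrite big_ord0 min0n.
rewrite big_ord_recr /= IH -natrD; congr _%:R.
by case: leqP => ?; lia.
Qed.

(** * Majorants for the neighbourhood sums of all levels up to L *)

Section maximal.
Variables (R : realType) (m : nat -> nat) (B : nat) (p : R).
Hypothesis m_ge2 : forall k, (2 <= m k)%N.
Hypothesis mB : forall k, (m k <= B)%N.
Hypotheses (p0 : 0 < p) (p12 : p <= 2^-1).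
Local Notation M := (gen_base m).
Local Notation G := (vilenkin m).
Local Notation weight := (weight m p).
Local Notation D := (1 - rho p)^-1.

Definition nbr_sum (L l : nat) (h : G -> R) (x : G) : R :=
  \sum_(s < l.+1) \sum_(t < s.+1) weight s t * navg L s t h x.

Lemma avg_weight_navg L s t (h : G -> R) : (t <= s)%N -> (s <= L)%N ->
  (forall x, 0 <= h x) ->
  avg L (fun x => weight s t * navg L s t h x) <=
  rho p ^+ (s - t) * sigma p ^+ s * (B%:R * avg L h).
Proof.
move=> ts sL h0; rewrite avgZ.
apply: le_trans (ler_wpM2l (weight_ge0 _ _ _ _) (avg_navg m_ge2 mB _ sL h0)) _.
rewrite [leLHS](_ : _ = weight s t / (M s)%:R * (B%:R * avg L h)); last by ring.
by rewrite ler_wpM2r ?(mulr_ge0 (ler0n _ _)) ?avg_ge0 ?weight_le.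
Qed.

Lemma nbr_sum_ge0 L l (h : G -> R) x : (forall y, 0 <= h y) -> 0 <= nbr_sum L l h x.
Proof.
move=> h0; apply: sumr_ge0 => s _; apply: sumr_ge0 => t _.
by rewrite mulr_ge0 ?weight_ge0 ?navg_ge0.
Qed.

Lemma rho_series_gt0 : 0 < D.
Proof. by rewrite geo_D_gt0 // ?rho_lt1. Qed.

Lemma rho_row_le s : \sum_(t < s.+1) rho p ^+ (s - t) <= D.
Proof.
apply: le_trans (geo_head (rho_gt0 p) (rho_lt1 p0) s s.+1).
by apply: ler_sum => t _; rewrite -ltnS ltn_ord mul1r.
Qed.

Lemma maximal_below_half (g : nat -> G -> R) L : p < 2^-1 ->
  (forall l x, 0 <= g l x) -> (forall l x, g l x <= g l.+1 x) ->
  exists Th : G -> R, [/\ forall x, 0 <= Th x,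
    forall l x, (l <= L)%N -> nbr_sum L l (g l) x <= Th x &
    avg L Th <= (D * (1 - sigma p)^-1 * B%:R) * avg L (g L)].
Proof.
move=> p2 g0 gS.
have gm l k x : (l <= k)%N -> g l x <= g k x.
  by move=> /subnKC <-; elim: (k - l)%N => [|d IH]; rewrite ?addn0 // addnS (le_trans IH).
have Ba0 : 0 <= B%:R * avg L (g L) by rewrite (mulr_ge0 (ler0n _ _)) ?avg_ge0.
(* The sum of top level dominates all others, since both g_l and the set of pairs grow with l. *)
exists (nbr_sum L L (g L)); split => [x|l x lL|]; first exact: nbr_sum_ge0.
  apply: (@le_trans _ _ (nbr_sum L l (g L) x)).
    apply: ler_sum => s _; apply: ler_sum => t _.
    by rewrite ler_wpM2l ?weight_ge0 // ler_navg // => y; apply: gm.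
  rewrite /nbr_sum (big_ord_widen L.+1
    (fun s => \sum_(t < s.+1) weight s t * navg L s t (g L) x)) //.
  rewrite [leRHS](bigID (fun s : 'I_L.+1 => (s < l.+1)%N)) /= lerDl.
  apply: sumr_ge0 => s _; apply: sumr_ge0 => t _.
  by rewrite mulr_ge0 ?weight_ge0 ?navg_ge0.
rewrite /nbr_sum avg_sum.
apply: (@le_trans _ _ (\sum_(s < L.+1) sigma p ^+ s * (D * (B%:R * avg L (g L))))).
  apply: ler_sum => s _; rewrite avg_sum.
  apply: (@le_trans _ _ (\sum_(t < s.+1)
      rho p ^+ (s - t) * sigma p ^+ s * (B%:R * avg L (g L)))).
    by apply: ler_sum => t _; rewrite avg_weight_navg // -ltnS.
  rewrite -!mulr_suml [X in X * _]mulrC -mulrA.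
  by rewrite ler_wpM2l ?exprn_ge0 ?(ltW (sigma_gt0 p)) // ler_wpM2r ?rho_row_le.
rewrite -mulr_suml mulrA -[leRHS]mulrA ler_wpM2r //.
rewrite mulrC ler_wpM2l ?(ltW rho_series_gt0) //.
apply: le_trans (geo_tail (sigma_gt0 p) (sigma_lt1 p2) 0 L.+1).
by apply: ler_sum => s _; rewrite leq0n mul1r subn0.
Qed.

Lemma maximal_half (g : nat -> G -> R) L : p = 2^-1 ->
  (forall l x, 0 <= g l x) -> (forall l x, g l x <= g l.+1 x) ->
  (forall l, level_fun l (g l)) ->
  exists Th : G -> R, [/\ forall x, 0 <= Th x,
    forall l x, (0 < l <= L)%N -> nbr_sum L l (g l) x <= l%:R * Th x &
    avg L Th <= (2 * D * B%:R + D ^+ 2 * B%:R + 2 * B%:R * D) * avg L (g L)].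
Proof.
move=> p2 g0 gS gl.
have sig1 : sigma p = 1 by rewrite /sigma p2 divff // subrr powRr0.
pose d k x := if k is k'.+1 then g k x - g k' x else g 0%N x.
have d0 k x : 0 <= d k x by case: k => //= k; rewrite subr_ge0.
have dl k : level_fun k (d k).
  case: k => [|k] x y H /=; first exact: gl.
  by rewrite (gl k.+1 x y H) (gl k x y) // => i ik; apply: H; rewrite ltnW.
have dE l x : g l x = \sum_(k < l.+1) d k x.
  elim: l => [|l IH]; first by rewrite big_ord1.
  by rewrite big_ord_recr /= -IH addrC subrK.
pose X1 k x := \sum_(s < L.+1) \sum_(t < s.+1)
   (s <= k)%:R * (weight s t * navg L s t (d k) x).
pose X2 k x := \sum_(s < L.+1) \sum_(t < s.+1)
   ((t < k) && (k < s))%N%:R * (weight s t * navg L s t (d k) x).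
(* One term for each range of the overview. For k <= l and l >= 1, k + 1 <= 2 l explains 2 / (k +
   1); the last factor 2 comes from l + 1 <= 2 l, as each of the l + 1 rows s contributes at most B
   D d_k. *)
pose W k x := 2 / k.+1%:R * X1 k x + X2 k x + 2 * (B%:R * D * d k x).
have wn0 k s t x : 0 <= weight s t * navg L s t (d k) x.
  by rewrite mulr_ge0 ?weight_ge0 ?navg_ge0.
have X10 k x : 0 <= X1 k x.
  by apply: sumr_ge0 => s _; apply: sumr_ge0 => t _; rewrite mulr_ge0.
have X20 k x : 0 <= X2 k x.
  by apply: sumr_ge0 => s _; apply: sumr_ge0 => t _; rewrite mulr_ge0.
have BDd0 k x : 0 <= B%:R * D * d k x by rewrite !mulr_ge0 ?(ltW rho_series_gt0).
have W0 k x : 0 <= W k x.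
  by rewrite /W !addr_ge0 // mulr_ge0.
exists (fun x => \sum_(k < L.+1) W k x); split.
- by move=> x; apply: sumr_ge0.
- move=> l x /andP[l0 lL].
  (* Only the range k <= t, k < s has a pointwise bound, by [navg_level]. The other two ranges keep
     their averages, which are estimated after averaging in x. *)
  have pair k s t : (t <= s)%N -> (s <= L)%N ->
      weight s t * navg L s t (d k) x <=
      (s <= k)%:R * (weight s t * navg L s t (d k) x) +
      ((t < k) && (k < s))%N%:R * (weight s t * navg L s t (d k) x) +
      rho p ^+ (s - t) * (B%:R * d k x).
    move=> ts sL; have R0 : 0 <= rho p ^+ (s - t) * (B%:R * d k x).
      by rewrite !mulr_ge0 ?exprn_ge0 ?(ltW (rho_gt0 _)).
    have := wn0 k s t x; set w := _ * navg _ _ _ _ _ => w0.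
    have [sk|ks] := leqP s k; first by rewrite mul1r -addrA lerDl addr_ge0 // mulr_ge0.
    have [tk|kt] := ltnP t k; first by rewrite mul0r add0r mul1r lerDl.
    rewrite !mul0r !add0r.
    have := navg_level m_ge2 mB x sL ts kt (d0 k) (dl k).
    move=> /(ler_wpM2l (weight_ge0 m p s t)) /le_trans; apply.
    rewrite [leLHS](_ : _ = weight s t / (M s)%:R * (B%:R * d k x)); last by ring.
    rewrite ler_wpM2r ?mulr_ge0 //; apply: le_trans (weight_le _ _ _ ts) _ => //.
    by rewrite sig1 expr1n mulr1.
  have Uk k : (k <= l)%N -> nbr_sum L l (d k) x <= l%:R * W k x.
    move=> kl.
    apply: (@le_trans _ _ (X1 k x + X2 k x + l.+1%:R * (B%:R * D * d k x))).
      apply: (@le_trans _ _ (\sum_(s < l.+1) \sum_(t < s.+1) (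
        (s <= k)%:R * (weight s t * navg L s t (d k) x) +
        ((t < k) && (k < s))%N%:R * (weight s t * navg L s t (d k) x) +
        rho p ^+ (s - t) * (B%:R * d k x)))).
        apply: ler_sum => s _; apply: ler_sum => t _; apply: pair.
          by rewrite -ltnS.
        by apply: leq_trans lL; rewrite -ltnS.
      under eq_bigr do rewrite !big_split /=.
      rewrite !big_split /=.
      have widen (F : nat -> R) : (forall s, 0 <= F s) ->
          \sum_(s < l.+1) F s <= \sum_(s < L.+1) F s.
        move=> F0; rewrite (big_ord_widen L.+1 F) //.
        rewrite [leRHS](bigID (fun s : 'I_L.+1 => (s < l.+1)%N)) /= lerDl.
        by apply: sumr_ge0.
      apply: lerD; first apply: lerD.
      + apply: (widen (fun s => \sum_(t < s.+1)
          (s <= k)%:R * (weight s t * navg L s t (d k) x))) => s.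
        by apply: sumr_ge0 => t _; rewrite mulr_ge0.
      + apply: (widen (fun s => \sum_(t < s.+1)
          ((t < k) && (k < s))%N%:R * (weight s t * navg L s t (d k) x))) => s.
        by apply: sumr_ge0 => t _; rewrite mulr_ge0.
      apply: (@le_trans _ _ (\sum_(s < l.+1) (B%:R * D * d k x))).
        apply: ler_sum => s _; rewrite -mulr_suml.
        rewrite [leRHS](_ : _ = D * (B%:R * d k x)); last by ring.
        by rewrite ler_wpM2r ?mulr_ge0 ?rho_row_le.
      by rewrite sumr_const card_ord [leRHS]mulr_natl.
    rewrite /W 2!mulrDr; apply: lerD; first apply: lerD.
    - rewrite mulrA ler_peMl // mulrCA mulrA ler_pdivlMr ?ltr0n // mul1r.
      by rewrite -natrM ler_nat; lia.
    - by rewrite ler_peMl // ler1n.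
    by rewrite [leRHS]mulrA ler_wpM2r // -natrM ler_nat; lia.
  apply: (@le_trans _ _ (\sum_(k < l.+1) nbr_sum L l (d k) x)).
    rewrite /nbr_sum [leRHS]exchange_big; apply: ler_sum => s _ /=.
    rewrite exchange_big; apply: ler_sum => t _ /=.
    rewrite -mulr_sumr ler_wpM2l ?weight_ge0 // /navg -avg_sum.
    by apply: ler_avg => y; rewrite dE mulr_sumr.
  apply: (@le_trans _ _ (\sum_(k < l.+1) l%:R * W k x)).
    by apply: ler_sum => k _; apply: Uk; rewrite -ltnS.
  rewrite -mulr_sumr ler_wpM2l //.
  rewrite (big_ord_widen L.+1 (fun k => W k x)) //.
  rewrite [leRHS](bigID (fun s : 'I_L.+1 => (s < l.+1)%N)) /= lerDl.
  by apply: sumr_ge0.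
(* The increments add up to g_L under the average, so each k may be treated separately. *)
rewrite avg_sum (_ : avg L (g L) = \sum_(k < L.+1) avg L (d k)); last first.
  by rewrite -avg_sum; congr avg; apply: funext => x; rewrite dE.
rewrite mulr_sumr; apply: ler_sum => k _.
rewrite /W !avgD !avgZ.
have a0 : 0 <= avg L (d k) by apply: avg_ge0.
have Ba0 : 0 <= B%:R * avg L (d k) by rewrite (mulr_ge0 (ler0n _ _)).
have D0 := ltW rho_series_gt0.
have wavg s t : (t <= s)%N -> (s <= L)%N ->
    avg L (fun x => weight s t * navg L s t (d k) x) <=
    rho p ^+ (s - t) * (B%:R * avg L (d k)).
  move=> ts sL; apply: le_trans (avg_weight_navg ts sL (d0 k)) _.
  by rewrite sig1 expr1n mulr1.
(* At most k + 1 rows s <= k, each bounded by a geometric series; this count is what 2 / (k + 1)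
   absorbs. *)
have E1 : avg L (X1 k) <= k.+1%:R * (D * (B%:R * avg L (d k))).
  rewrite avg_sum.
  apply: (@le_trans _ _ (\sum_(s < L.+1) (s <= k)%:R * (D * (B%:R * avg L (d k))))).
    apply: ler_sum => s _; rewrite avg_sum.
    apply: (@le_trans _ _ (\sum_(t < s.+1) (s <= k)%:R *
       (rho p ^+ (s - t) * (B%:R * avg L (d k))))).
      by apply: ler_sum => t _; rewrite avgZ ler_wpM2l // wavg // -ltnS.
    by rewrite -mulr_sumr -mulr_suml ler_wpM2l // ler_wpM2r ?rho_row_le.
  by rewrite -mulr_suml ler_wpM2r ?sum_leq_le // (mulr_ge0 D0).
(* For t < k < s, rho^(s - t) = rho^(s - k) rho^(k - t), so two geometric series give D^2. *)
have E2 : avg L (X2 k) <= D ^+ 2 * (B%:R * avg L (d k)).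
  rewrite avg_sum.
  apply: (@le_trans _ _ (\sum_(s < L.+1) (k <= s)%N%:R * rho p ^+ (s - k) *
     (D * (B%:R * avg L (d k))))).
    apply: ler_sum => s _; rewrite avg_sum.
    apply: (@le_trans _ _ (\sum_(t < s.+1) ((k <= s)%N%:R * rho p ^+ (s - k)) *
       ((t <= k)%N%:R * rho p ^+ (k - t) * (B%:R * avg L (d k))))).
      apply: ler_sum => t _; rewrite avgZ.
      have r0 := ltW (rho_gt0 p).
      case: (boolP ((t < k) && (k < s))%N) => [/andP[tk ks]|_]; last first.
        by rewrite mul0r; apply: mulr_ge0; [rewrite mulr_ge0 ?exprn_ge0|
          apply: mulr_ge0 => //; rewrite mulr_ge0 ?exprn_ge0].
      rewrite (ltnW tk) (ltnW ks) !mul1r mulrA -exprD.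
      rewrite addnBA ?(ltnW tk) // subnK ?(ltnW ks) //.
      by apply: wavg; rewrite -ltnS.
    rewrite -mulr_sumr -mulr_suml ler_wpM2l ?mulr_ge0 ?exprn_ge0 ?(ltW (rho_gt0 p)) //.
    by rewrite ler_wpM2r // geo_head ?rho_gt0 ?rho_lt1.
  rewrite -mulr_suml expr2 -mulrA ler_wpM2r ?(mulr_ge0 D0) //.
  by rewrite geo_tail ?rho_gt0 ?rho_lt1.
have E3 : 2 / k.+1%:R * avg L (X1 k) <= 2 * D * B%:R * avg L (d k).
  rewrite mulrAC ler_pdivrMr ?ltr0n // -!mulrA ler_wpM2l //.
  by apply: le_trans E1 _; rewrite mulrC !mulrA.
apply: le_trans (lerD (lerD E3 E2) (lexx _)) _.
by rewrite le_eqVlt; apply/orP; left; apply/eqP; ring.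
Qed.

End maximal.

(** * From kernels to the means *)

Section powR_facts.
Variable R : realType.

(** For c = a and c = b the ratio c / (a + b) lies in [0, 1], hence is at most its own p-th power;
    the two inequalities are added. *)
Lemma powR_subadd (p a b : R) : 0 < p -> p <= 1 -> 0 <= a -> 0 <= b ->
  (a + b) `^ p <= a `^ p + b `^ p.
Proof.
move=> p0 p1 a0 b0; have := addr_ge0 a0 b0; rewrite le0r => /orP[/eqP ab|ab].
  by rewrite ab powR0 ?gt_eqF // addr_ge0 ?powR_ge0.
have key c : 0 <= c -> c <= a + b -> c / (a + b) * (a + b) `^ p <= c `^ p.
  rewrite le0r => /orP[/eqP -> _|c0 cab]; first by rewrite mul0r mul0r powR_ge0.
  have cE : c = c / (a + b) * (a + b) by rewrite divfK ?gt_eqF.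
  rewrite [X in _ <= X `^ _]cE powRM ?divr_ge0 ?(ltW c0) ?(ltW ab) // ler_wpM2r ?powR_ge0 //.
  by rewrite ger1_powR // divr_gt0 //= ler_pdivrMr // mul1r.
apply: le_trans (lerD (key a a0 _) (key b b0 _)); rewrite ?lerDl ?lerDr //.
by rewrite -mulrDl -mulrDl divff ?gt_eqF // mul1r.
Qed.

Lemma powR_sum_le (p : R) (I : Type) (s : seq I) (F : I -> R) :
  0 < p -> p <= 1 -> (forall i, 0 <= F i) ->
  (\sum_(i <- s) F i) `^ p <= \sum_(i <- s) F i `^ p.
Proof.
move=> p0 p1 F0; elim: s => [|i s IH]; first by rewrite !big_nil powR0 ?gt_eqF.
rewrite !big_cons; apply: le_trans (powR_subadd p0 p1 _ _) _ => //.
  by rewrite sumr_ge0.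
by rewrite lerD2l.
Qed.

End powR_facts.

(** * Pointwise bounds for P_n and for the means *)

Section fejer_bound.
Variables (R : realType) (m : nat -> nat) (B : nat) (p : R).
Hypothesis m_ge2 : forall k, (2 <= m k)%N.
Hypothesis mB : forall k, (m k <= B)%N.
Hypotheses (p0 : 0 < p) (p12 : p <= 2^-1).
Local Notation M := (gen_base m).
Local Notation G := (vilenkin m).
Local Notation C := R[i].
Local Open Scope complex_scope.

Lemma psi_level n l : (n < M l)%N -> level_fun l (@psi R m n).
Proof.
move=> nl x y xy; rewrite [LHS](chiE m_ge2 (fun k => rademacher R k x) nl).
rewrite [RHS](chiE m_ge2 (fun k => rademacher R k y) nl).
by apply: eq_bigr => k _; rewrite /rademacher xy.
Qed.

Lemma partial_sum_level (c : nat -> C) n l : (n <= M l)%N ->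
  level_fun l (@partial_sum R m c n).
Proof.
move=> nl x y xy; apply: eq_bigr => k _; congr (_ * _).
by apply: (psi_level _ xy); apply: leq_trans nl.
Qed.

(* The factor M_l^(1-p), instead of the M_l^(-p) of the kernel, is the price of
   l^p in l^1 summed over the M_l cylinders. *)
Lemma fejer_sum_powR (c : nat -> C) n l L x : (n <= M l)%N -> (l <= L)%N ->
  cabs (\sum_(k < n) partial_sum c k x) `^ p <=
  (2 * B ^ 2)%:R `^ p * (M l)%:R `^ (1 - p) *
    nbr_sum p L l (fun y : G => cabs (partial_sum c (M l) y) `^ p) x.
Proof.
move=> nl lL; have Ml0 : (0 : R) < (M l)%:R by apply: natr_gen_base_gt0.
have p1 : p <= 1 by apply: le_trans p12 _; rewrite invf_le1 // ler1n.
set h := fun y : G => _.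
have nbrl s t x' : (s <= l)%N -> level_fun l (fun y : G => (nbr s t x' y)%:R * h y).
  move=> sl y z yz; rewrite /h (partial_sum_level c (leqnn _) yz).
  congr (_%:R * _); apply: congr1; apply: eq_forallb => i; rewrite yz //.
  exact: leq_trans (ltn_ord i) sl.
have H := cabs_sum_partial_sum m_ge2 c x mB nl.
have {}H : ((M l)%:R * cabs (\sum_(k < n) partial_sum c k x)) `^ p <=
   (\sum_(y < M l) \sum_(s < l.+1) \sum_(t < s.+1)
     (cabs (partial_sum c (M l) (rep m y)) *
      ((nbr s t x (rep m y))%:R * (2 * B ^ 2 * (M t * M s))%:R))) `^ p.
  rewrite ge0_ler_powR ?nnegrE ?(ltW p0) ?mulr_ge0 ?cabs_ge0 //.
    by do 3 (apply: sumr_ge0 => ? _); rewrite !mulr_ge0 ?cabs_ge0.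
  apply: le_trans H _; apply: ler_sum => y _; rewrite mulr_sumr.
  by apply: ler_sum => s _; rewrite mulr_sumr.
(* As p <= 1, the p-th power passes inside all three sums; the indicator is its own p-th power. *)
have {}H : ((M l)%:R * cabs (\sum_(k < n) partial_sum c k x)) `^ p <=
   \sum_(y < M l) \sum_(s < l.+1) \sum_(t < s.+1)
     (2 * B ^ 2)%:R `^ p * (weight m p s t *
        ((nbr s t x (rep m y))%:R * h (rep m y))).
  apply: le_trans H _.
  apply: le_trans (powR_sum_le _ p0 p1 _) _ => [y|].
    by do 2 (apply: sumr_ge0 => ? _); rewrite !mulr_ge0 ?cabs_ge0.
  apply: ler_sum => y _; apply: le_trans (powR_sum_le _ p0 p1 _) _ => [s|].
    by apply: sumr_ge0 => ? _; rewrite !mulr_ge0 ?cabs_ge0.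
  apply: ler_sum => s _; apply: le_trans (powR_sum_le _ p0 p1 _) _ => [t|].
    by rewrite !mulr_ge0 ?cabs_ge0.
  apply: ler_sum => t _; rewrite [(2 * B ^ 2 * _)%:R]natrM.
  have powR4 (a b e d : R) : 0 <= a -> 0 <= b -> 0 <= e -> 0 <= d ->
      (a * (b * (e * d))) `^ p = a `^ p * (b `^ p * (e `^ p * d `^ p)).
    by move=> a0 b0 e0 d0; rewrite !powRM ?mulr_ge0.
  rewrite powR4 ?cabs_ge0 //.
  have -> : (nbr s t x (rep m y))%:R `^ p = (nbr s t x (rep m y))%:R :> R.
    by case: nbr; rewrite ?powR1 ?powR0 ?gt_eqF.
  by rewrite /weight /h le_eqVlt; apply/orP; left; apply/eqP; ring.
rewrite powRM ?cabs_ge0 ?(ltW Ml0) // in H.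
have Mp0 : 0 < (M l)%:R `^ p :> R by rewrite powR_gt0.
(* Multiplication by M_l^p turns M_l^(1 - p) into M_l, which undoes the normalization of [avg] at
   level l. *)
rewrite -(ler_pM2l Mp0); apply: le_trans H _.
have -> : (M l)%:R `^ p * ((2 * B ^ 2)%:R `^ p * (M l)%:R `^ (1 - p) *
    nbr_sum p L l h x) = (2 * B ^ 2)%:R `^ p * ((M l)%:R * nbr_sum p L l h x) :> R.
  have Eab : (M l)%:R `^ p * (M l)%:R `^ (1 - p) = (M l)%:R :> R.
    rewrite -powRD; last by rewrite (gt_eqF Ml0) implybT.
    by rewrite addrC subrK powRr1 // ltW.
  by rewrite -[in RHS]Eab; ring.
rewrite exchange_big /=; under eq_bigr do rewrite exchange_big /=.
under eq_bigr => s _ do under eq_bigr => t _ do rewrite -!mulr_sumr.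
under eq_bigr do rewrite -mulr_sumr.
rewrite -mulr_sumr ler_wpM2l ?powR_ge0 // /nbr_sum mulr_sumr.
apply: ler_sum => s _; rewrite mulr_sumr; apply: ler_sum => t _.
rewrite mulrCA ler_wpM2l ?weight_ge0 // /navg (avg_level m_ge2 lL); last first.
  by apply: nbrl; rewrite -ltnS.
by rewrite /avg mulrA divff ?gt_eqF // mul1r.
Qed.

(** For the coefficients of a martingale f this is the maximum of |f^(k)|^p over k <= l, because
    S_{M_k} f = f^(k). *)
Fixpoint run_max (c : nat -> C) (l : nat) (x : G) : R :=
  let v := cabs (partial_sum c (M l) x) `^ p in
  if l is l'.+1 then Num.max (run_max c l' x) v else v.

Lemma le_run_max c l x : cabs (partial_sum c (M l) x) `^ p <= run_max c l x.
Proof. by case: l => [|l] /=; rewrite ?le_max lexx ?orbT. Qed.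

Lemma run_max_ge0 c l x : 0 <= run_max c l x.
Proof. by apply: le_trans (le_run_max c l x); rewrite powR_ge0. Qed.

Lemma run_maxS c l x : run_max c l x <= run_max c l.+1 x.
Proof. by rewrite /= le_max lexx. Qed.

Lemma run_max_level c l : level_fun l (run_max c l).
Proof.
elim: l => [|l IH] x y xy /=; first by rewrite (partial_sum_level c (leqnn _) xy).
rewrite (partial_sum_level c (leqnn _) xy) (IH x y) // => i il.
by rewrite xy // ltnW.
Qed.

Definition log_weight (j : nat) : R :=
  j.+1%:R `^ (p^-1 - 2) * ln j.+1%:R ^ (2 * Num.floor (2^-1 + p)).

(** The integer part of 1/2 + p is 1 for p = 1/2 and 0 below, so the logarithm appears at the
    endpoint only. *)
Lemma log_weightE j : log_weight j =
  j.+1%:R `^ (p^-1 - 2) * (if p == 2^-1 then ln j.+1%:R ^+ 2 else 1).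
Proof.
rewrite /log_weight; have [p2|ne] := eqVneq p 2^-1.
  have -> : 2^-1 + p = 1 by rewrite p2; lra.
  by rewrite floor1.
have pl : p < 2^-1 by rewrite lt_neqAle ne.
rewrite (_ : Num.floor _ = 0) //; apply: floor_def.
rewrite mulr0z add0r mulr1z addr_ge0 ?ltW //=.
by rewrite -ltrBrDl (lt_le_trans pl) // [leRHS](_ : _ = 2^-1) //; lra.
Qed.

Lemma ln_natS_gt0 j : (0 < j)%N -> 0 < ln j.+1%:R :> R.
Proof. by move=> j0; rewrite ln_gt0 // ltr1n. Qed.

Lemma log_weight_gt0 j : (0 < j)%N -> 0 < log_weight j.
Proof.
by move=> j0; rewrite mulr_gt0 ?powR_gt0 ?ltr0n // exprz_gt0 // ln_natS_gt0.
Qed.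

Lemma log_weight_homo i j : (0 < i)%N -> (i <= j)%N -> log_weight i <= log_weight j.
Proof.
move=> i0 ij; have pV : 2 <= p^-1 by rewrite -[2]invrK lef_pV2 ?posrE ?invr_gt0.
have ij1 : i.+1%:R <= j.+1%:R :> R by rewrite ler_nat.
rewrite !log_weightE ler_pM ?powR_ge0 //.
- by case: ifP; rewrite ?exprn_ge0 // ltW // ln_natS_gt0.
- by rewrite ge0_ler_powR ?nnegrE // subr_ge0.
case: ifP => // _; rewrite ler_pXn2r ?nnegrE ?(ltW (ln_natS_gt0 i0))
  ?(ltW (ln_natS_gt0 (leq_trans i0 ij))) //.
by rewrite ler_ln ?posrE.
Qed.

(** From M_(l-1) <= j one gets M_l <= B j. For p < 1/2 the powers match by (1/p - 2) p = 1 - 2p; for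
    p = 1/2 the logarithm pays for l. The constant 2 / ln 2 + 1 covers both cases. *)
Lemma log_weight_powR j l : (0 < j)%N -> (0 < l)%N -> (M l.-1 <= j)%N ->
  (M l)%:R `^ (1 - p) * (if p == 2^-1 then l%:R else 1) <=
  (B%:R * (2 / ln 2 + 1)) * (j%:R * log_weight j) `^ p.
Proof.
move=> j0 l0 Mj; have p1 : p < 1 by apply: le_lt_trans p12 _; rewrite invf_lt1 ?ltr1n.
have ln20 : 0 < ln 2 :> R by rewrite ln_gt0 // ltr1n.
have jR : (0 : R) < j%:R by rewrite ltr0n.
have B1 : (1 : R) <= B%:R by rewrite ler1n (leq_trans _ (mB 0)) // (leq_trans _ (m_ge2 0)).
have Mle : (M l)%:R `^ (1 - p) <= B%:R * j%:R `^ (1 - p) :> R.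
  apply: (@le_trans _ _ ((B%:R * j%:R) `^ (1 - p))).
    rewrite ge0_ler_powR ?nnegrE ?mulr_ge0 ?subr_ge0 ?(ltW p1) //.
    rewrite -natrM ler_nat -(prednK l0) gen_baseS leq_mul //.
  rewrite powRM // ler_wpM2r ?powR_ge0 // ler1_powR //.
  by rewrite gerBl ltW.
have j1R : j%:R <= j.+1%:R :> R by rewrite ler_nat.
have Q0 := powR_ge0 (j%:R * log_weight j) p.
have D0 : 0 <= 2 / ln 2 :> R by rewrite divr_ge0 // ltW.
rewrite log_weightE; case: eqVneq => [p2|ne].
  have L0 := ltW (ln_natS_gt0 j0).
  have -> : (j%:R * (j.+1%:R `^ (p^-1 - 2) * ln j.+1%:R ^+ 2)) `^ p =
      j%:R `^ (1 - p) * ln j.+1%:R :> R.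
    rewrite {1}p2 invrK subrr powRr0 mul1r powRM ?exprn_ge0 //.
    rewrite {2}p2 powR12_sqrt ?exprn_ge0 // sqrtr_sqr ger0_norm //.
    by congr (_ `^ _ * _); rewrite p2; lra.
  (* Logarithms of 2^l <= 2 j <= (j + 1)^2. *)
  have Hl : l%:R <= 2 / ln 2 * ln j.+1%:R :> R.
    rewrite mulrAC ler_pdivlMr // !mulr_natl -!lnXn ?ltr0n // ler_ln ?posrE ?exprn_gt0 //.
    rewrite -!natrX ler_nat; have := gen_base_exp2 m_ge2 (leq0n l.-1).
    rewrite gen_base0 mul1n subn0 => /leq_trans/(_ Mj) H.
    rewrite -(prednK l0) expnS; apply: leq_trans (leq_mul (leqnn 2) H) _.
    by rewrite -mulnn leq_mul // ltnS.
  apply: (@le_trans _ _ (B%:R * j%:R `^ (1 - p) * (2 / ln 2 * ln j.+1%:R))).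
    by rewrite ler_pM ?powR_ge0.
  rewrite [leLHS](_ : _ = B%:R * (2 / ln 2) * (j%:R `^ (1 - p) * ln j.+1%:R)); last by ring.
  by rewrite ler_wpM2r ?mulr_ge0 ?powR_ge0 // ler_wpM2l // lerDl.
rewrite !mulr1; apply: le_trans Mle _.
rewrite mulrDr mulr1 mulrDl -[leLHS]add0r lerD ?mulr_ge0 ?powR_ge0 ?invr_ge0 ?(ltW ln20) //.
rewrite ler_wpM2l // powRM ?powR_ge0 // -powRrM.
have -> : (p^-1 - 2) * p = 1 - p - p.
  by rewrite mulrBl mulVf ?gt_eqF // mulr_natl mulr2n opprD addrA.
have -> : j%:R `^ (1 - p) = j%:R `^ p * j%:R `^ (1 - p - p) :> R.
  by rewrite -powRD ?(gt_eqF jR) ?implybT // [p + _]addrC subrK.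
rewrite ler_wpM2l ?powR_ge0 //.
rewrite ge0_ler_powR ?nnegrE //.
by rewrite -addrA -opprD subr_ge0 -mulr2n -mulr_natr -ler_pdivlMr ?mul1r.
Qed.

Lemma abel_sum (S : nat -> C) (q : nat -> R) n :
  \sum_(k < n) (q k)%:C * S k =
  \sum_(k < n) (q k - q k.+1)%:C * \sum_(i < k.+1) S i +
    (q n)%:C * \sum_(i < n) S i.
Proof.
elim: n => [|n IH]; first by rewrite !big_ord0 mulr0 addr0.
rewrite [in LHS]big_ord_recr [in X in _ = X + _]big_ord_recr /= IH rmorphB /=.
by rewrite [\sum_(i < n.+1) S i]big_ord_recr /=; ring.
Qed.

(* The bound k.-1 reflects S_0 f = 0: the k-th sum has k - 1 nonzero terms. *)
Lemma cabs_abel_sum (S : nat -> C) (q : nat -> R) n (A : R) :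
  (forall k, 0 <= q k) -> nonincreasing_seq q ->
  (forall k, (k <= n)%N -> cabs (\sum_(i < k) S i) <= k.-1%:R * A) ->
  0 <= A ->
  cabs (\sum_(k < n) (q k)%:C * S k) <= (\sum_(k < n) q k) * A.
Proof.
move=> q0 qS HS A0; rewrite abel_sum.
have qS' k : 0 <= q k - q k.+1 by rewrite subr_ge0; apply: qS.
rewrite -lecR -cabsE; apply: le_trans (ler_normD _ _) _.
rewrite !cabsE -rmorphD lecR.
apply: (@le_trans _ _ (\sum_(k < n) (q k - q k.+1) * (k%:R * A) + q n * (n.-1%:R * A))).
  apply: lerD; last first.
    by rewrite cabsM cabs_real // ler_wpM2l // HS.
  apply: le_trans (cabs_sum _ _ _) _; apply: ler_sum => k _.
  by rewrite cabsM cabs_real // ler_wpM2l // (HS k.+1).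
under eq_bigr do rewrite mulrA.
rewrite -mulr_suml mulrA -mulrDl ler_wpM2r //.
(* After n - 1 is relaxed to n, the left side is q_1 + ... + q_n, at most q_0 + ... + q_(n-1) by
   monotonicity. *)
suff : \sum_(k < n) (q k - q k.+1) * k%:R + q n * n%:R <= \sum_(k < n) q k.
  apply: le_trans; rewrite lerD2l ler_wpM2l // ler_nat.
  exact: leq_pred.
elim: n {HS} => [|n IH]; first by rewrite !big_ord0 mulr0 addr0.
rewrite !big_ord_recr /= -natr1 -addrA.
have -> : (q n - q n.+1) * n%:R + q n.+1 * (n%:R + 1) = q n * n%:R + q n.+1 by ring.
by rewrite addrA lerD // qS.
Qed.

(** [T_mean] as a function of the coefficients alone, which keeps the measure out of the pointwise
    estimates. *)
Definition T_coef (q : nat -> R) (c : nat -> C) (n : nat) (x : G) : C :=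
  (\sum_(k < n) q k)^-1%:C * \sum_(k < n) (q k)%:C * partial_sum c k x.

Lemma T_coef_level (q : nat -> R) (c : nat -> C) n l : (n <= M l)%N ->
  level_fun l (T_coef q c n).
Proof.
move=> nl x y xy; rewrite /T_coef.
suff -> : \sum_(k < n) (q k)%:C * partial_sum c k x =
  \sum_(k < n) (q k)%:C * partial_sum c k y by [].
apply: eq_bigr => k _; rewrite (partial_sum_level c _ xy) //.
by apply: leq_trans nl; apply: ltnW.
Qed.

(** With H^p = [K2 * Th x], each P_(j+1) with 0 < j < n is at most j w H, the weight of j being
    replaced by the larger weight w of n. Abel summation carries this over to the mean. Neither [K2]
    nor [Th] depends on n. *)
Lemma T_coef_maximal (q : nat -> R) :
  (forall k, 0 <= q k) -> nonincreasing_seq q -> 0 < q 0%N ->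
  exists2 K : R, 0 <= K & forall (c : nat -> C) (L : nat), exists Th : G -> R,
    (forall n x, (0 < n <= M L)%N ->
       (cabs (T_coef q c n x) / log_weight n) `^ p <= Th x) /\
    avg L Th <= K * avg L (run_max c L).
Proof.
move=> q0 qS q00.
(* The loss of the maximal inequality at level l: a factor l at p = 1/2, none below. *)
pose lam l : R := if p == 2^-1 then l%:R else 1.
have p1 : p < 1 by apply: le_lt_trans p12 _; rewrite invf_lt1 ?ltr1n.
have [K1 K10 HK1] : exists2 K1 : R, 0 <= K1 & forall c L, exists Th : G -> R,
   [/\ forall x, 0 <= Th x,
    forall l x, (0 < l <= L)%N -> nbr_sum p L l (run_max c l) x <= lam l * Th x &
    avg L Th <= K1 * avg L (run_max c L)].
  have D0 := ltW (rho_series_gt0 p0); have [p2|p2] := eqVneq p 2^-1.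
    eexists; last first => [c L|].
      rewrite /lam p2 eqxx -p2.
      exact: (maximal_half m_ge2 mB p0 p12 L p2 (run_max_ge0 c) (run_maxS c)
        (run_max_level c)).
    by rewrite !addr_ge0 ?mulr_ge0 ?exprn_ge0.
  have pl : p < 2^-1 by rewrite lt_neqAle p2.
  eexists; last first => [c L|].
    have [Th [Th0 H1 H2]] := maximal_below_half m_ge2 mB p0 p12 L pl (run_max_ge0 c)
      (run_maxS c).
    exists Th; split; [exact: Th0| |exact: H2] => l x /andP[_ lL].
    by rewrite /lam (negPf p2) mul1r H1.
  by rewrite !mulr_ge0 // invr_ge0 subr_ge0 ltW // sigma_lt1.
pose K2 : R := (2 * B ^ 2)%:R `^ p * (B%:R * (2 / ln 2 + 1)).
have ln20 : 0 < ln 2 :> R by rewrite ln_gt0 // ltr1n.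
have K20 : 0 <= K2.
  by rewrite /K2 !mulr_ge0 ?powR_ge0 // addr_ge0 // divr_ge0 // ltW.
exists (K2 * K1); first by rewrite mulr_ge0.
move=> c L; have [Th [Th0 HTh1 HTh2]] := HK1 c L.
exists (fun x => K2 * Th x); split; last by rewrite avgZ -mulrA ler_wpM2l.
move=> n x /andP[n0 nL]; set w := log_weight n.
have w0 : 0 < w by apply: log_weight_gt0.
have KT0 : 0 <= K2 * Th x by rewrite mulr_ge0.
pose H := (K2 * Th x) `^ p^-1.
have H0 : 0 <= H by apply: powR_ge0.
have HP j : (0 < j < n)%N ->
    cabs (\sum_(k < j.+1) partial_sum c k x) <= j%:R * (w * H).
  move=> /andP[j0 jn].
  (* The least level with j < M_l: P_(j+1) is then covered by level l, while M_l stays comparable to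
     j. *)
  have [l [l0 Mj jM]] : exists l, [/\ (0 < l)%N, (M l.-1 <= j)%N & (j < M l)%N].
    have ex : exists l, (j < M l)%N by exists j; apply: ltn_gen_base.
    case: (ex_minnP ex) => -[|l] jl lmin.
      by move: jl; rewrite gen_base0 ltnS leqNgt j0.
    exists l.+1; split => //=; rewrite leqNgt; apply/negP => /lmin.
    by rewrite ltnn.
  have lL : (l <= L)%N.
    rewrite leqNgt; apply/negP => Ll.
    have : (M L <= M l.-1)%N by apply: leq_gen_base => //; rewrite -ltnS prednK.
    by rewrite leqNgt (leq_ltn_trans Mj) // (leq_trans jn).
  have bound := fejer_sum_powR c x jM lL.
  have : cabs (\sum_(k < j.+1) partial_sum c k x) `^ p <= (j%:R * (w * H)) `^ p.
    apply: le_trans bound _.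
    apply: (@le_trans _ _ ((2 * B ^ 2)%:R `^ p * (M l)%:R `^ (1 - p) * (lam l * Th x))).
      rewrite ler_wpM2l ?mulr_ge0 ?powR_ge0 //.
      apply: le_trans (HTh1 l x _); last by rewrite l0.
      apply: ler_sum => s _; apply: ler_sum => t _; rewrite ler_wpM2l ?weight_ge0 //.
      by rewrite ler_navg // => y; apply: le_run_max.
    have := log_weight_powR j0 l0 Mj; rewrite -/(lam l) => Hlw.
    apply: (@le_trans _ _ ((j%:R * log_weight j) `^ p * (K2 * Th x))).
      rewrite [leRHS](_ : _ = (2 * B ^ 2)%:R `^ p * Th x *
         (B%:R * (2 / ln 2 + 1) * (j%:R * log_weight j) `^ p)); last by rewrite /K2; ring.
      rewrite [leLHS](_ : _ = (2 * B ^ 2)%:R `^ p * Th x *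
         ((M l)%:R `^ (1 - p) * lam l)); last by ring.
      by rewrite ler_wpM2l ?mulr_ge0 ?powR_ge0.
    have HpE : H `^ p = K2 * Th x by rewrite /H -powRrM mulVf ?gt_eqF // powRr1.
    have jw0 : 0 <= j%:R * w by rewrite (mulr_ge0 _ (ltW w0)).
    have jv0 : 0 <= j%:R * log_weight j by rewrite (mulr_ge0 _ (ltW (log_weight_gt0 j0))).
    rewrite [in leRHS]mulrA [leRHS]powRM // HpE ler_wpM2r //.
    rewrite ge0_ler_powR ?nnegrE ?(ltW p0) //.
    by rewrite ler_wpM2l // log_weight_homo // ltnW.
  have pn : 0 <= p^-1 by rewrite invr_ge0 ltW.
  move=> /(ge0_ler_powR pn); rewrite !nnegrE !powR_ge0 => /(_ isT isT).
  rewrite -!powRrM divff ?gt_eqF // !powRr1 ?cabs_ge0 //.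
  by rewrite (mulr_ge0 _ (mulr_ge0 (ltW w0) H0)).
have Q0 : 0 < \sum_(k < n) q k.
  by case: n n0 {nL w w0 HP H H0} => // n _; rewrite big_ord_recl ltr_pwDl ?sumr_ge0.
have main : cabs (T_coef q c n x) <= w * H.
  rewrite /T_coef cabsM cabs_real ?invr_ge0 ?(ltW Q0) // mulrC ler_pdivrMr //.
  rewrite [leRHS]mulrC; apply: (cabs_abel_sum (S := fun k => partial_sum c k x)) => //;
    last by rewrite (mulr_ge0 (ltW w0)).
  (* P_0 and P_1 vanish because S_0 f = 0, which agrees with the bound 0 for k = 0 and k = 1. *)
  case=> [|[|j]] jn.
  - by rewrite big_ord0 mul0r /cabs normr0.
  - by rewrite big_ord1 /partial_sum big_ord0 mul0r /cabs normr0.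
  by apply: HP.
apply: (@le_trans _ _ (H `^ p)).
  rewrite ge0_ler_powR ?nnegrE ?(ltW p0) ?(divr_ge0 (cabs_ge0 _) (ltW w0)) //.
  by rewrite ler_pdivrMr // mulrC.
by rewrite /H -powRrM mulVf ?gt_eqF // powRr1.
Qed.

End fejer_bound.

(** * Passage to the Haar measure *)

Section ereal_sup_power.
Variable R : realType.
Local Open Scope ereal_scope.

(* The maximal functions may be infinite, so p-th powers are exchanged with the
   supremum rather than with a limit of real numbers. *)
Lemma poweR_sup_lim (p : R) (P : set nat) (a b : nat -> R) : (0 < p)%R ->
  (forall n, 0 <= a n)%R -> {homo b : i j / (i <= j)%N >-> (i <= j)%R} ->
  (forall n, P n -> exists L, a n `^ p <= b L)%R ->
  (forall L, exists2 n, P n & b L <= a n `^ p)%R ->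
  (ereal_sup [set (a n)%:E | n in P]) `^ p = limn (fun L => (b L)%:E).
Proof.
move=> p0 a0 bS ab ba; set S := ereal_sup _.
have -> : limn (fun L => (b L)%:E) = ereal_sup (range (fun L => (b L)%:E)).
  apply/cvg_lim => //; apply: ereal_nondecreasing_cvgn => i j ij.
  by rewrite lee_fin bS.
set Y := ereal_sup (range (fun L => (b L)%:E)).
have aS n : P n -> (a n)%:E <= S by move=> Pn; apply: ereal_sup_ubound; exists n.
have bY L : (b L)%:E <= Y by apply: ereal_sup_ubound; exists L.
have S0 : 0 <= S.
  have [n Pn _] := ba 0%N; apply: le_trans (aS n Pn); rewrite lee_fin; exact: a0.
have Y0 : 0 <= Y.
  have [n Pn _] := ba 0%N; have [L HL] := ab n Pn; apply: le_trans (bY L).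
  by rewrite lee_fin (le_trans _ HL) // powR_ge0.
have inI (x : \bar R) : 0 <= x -> x \in `[0, +oo].
  by move=> x0; rewrite in_itv/= leey x0.
apply/eqP; rewrite eq_le; apply/andP; split.
  have : S <= Y `^ p^-1.
    apply: ge_ereal_sup => _ [n Pn <-]; have [L HL] := ab n Pn.
    have H : (a n `^ p)%:E <= Y by apply: le_trans (bY L); rewrite lee_fin.
    have pV : (0 <= p^-1)%R by rewrite invr_ge0 ltW.
    have := gt0_ler_poweR pV _ _ H; rewrite !inI // ?lee_fin ?powR_ge0 //.
    rewrite poweR_EFin -powRrM divff ?gt_eqF // powRr1 ?a0 // => ->//.
  move=> /(gt0_ler_poweR (ltW p0)) => /(_ (inI _ S0) (inI _ (poweR_ge0 _ _))).
  move=> /le_trans; apply; rewrite -poweRrM mulVf ?gt_eqF // poweRe1 //.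
apply: ge_ereal_sup => _ [L _ <-]; have [n Pn HL] := ba L.
apply: (@le_trans _ _ ((a n)%:E `^ p)); first by rewrite poweR_EFin lee_fin.
by rewrite gt0_ler_poweR ?inI ?lee_fin ?(ltW p0) ?aS.
Qed.

End ereal_sup_power.

(** * Haar measure of cylinders and integrals of level functions *)

Section haar.
Variables (R : realType) (m : nat -> nat) (mu : probability (vilenkin m) R).
Hypothesis m_ge2 : forall k, (2 <= m k)%N.
Hypothesis mu_haar : normalized_haar mu.
Local Notation M := (gen_base m).
Local Notation G := (vilenkin m).

Definition vzero : G := fun k => 0 : 'Z_(m k).

Lemma open_coord (k : nat) (a : 'Z_(m k)) :
  open ([set y | y k = a] : set (vilenkin_top m)).
Proof.
pose K (i : nat) : topologicalType := discrete_topology 'Z_(m i).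
have cK : continuous (proj k : prod_topology K -> K k) by exact: proj_continuous.
apply: (@open_comp _ _ _ [set a : K k] (fun x _ => cK x)).
exact: (@discrete_open (discrete_topology 'Z_(m k))).
Qed.

Lemma measurable_cylinder n (x : G) : measurable (cylinder n x).
Proof.
apply: sub_sigma_algebra; elim: n => [|n IH].
  have -> : cylinder 0 x = setT by apply/seteqP; split.
  exact: (@openT (vilenkin_top m)).
have -> : cylinder n.+1 x = cylinder n x `&` [set y : vilenkin_top m | y n = x n].
  apply/seteqP; split => [y H|y [H1 H2] k].
    by split => [k kn|]; apply: H => //; rewrite ltnS ltnW.
  by rewrite ltnS leq_eqVlt => /orP[/eqP ->|]; [exact: H2|exact: H1].
by apply: openI => //; exact: open_coord.
Qed.

Lemma cylinder_vadd n (a : G) :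
  vadd a @` cylinder n vzero = cylinder n a.
Proof.
apply/seteqP; split => [_ [y H <-] k kn|y H].
  by rewrite /vadd H // addr0.
exists (fun k => (y k : 'Z_(m k)) - a k).
  by move=> k kn; rewrite H // subrr.
by apply: functional_extensionality_dep => k; rewrite /vadd addrC subrK.
Qed.

Lemma mu_cylinder_rep n (x : G) :
  mu (cylinder n x) = mu (cylinder n vzero).
Proof. by rewrite -cylinder_vadd mu_haar //; apply: measurable_cylinder. Qed.

Lemma cylinder_code n (x : G) :
  exists2 j, (j < M n)%N & forall i, (i < n)%N -> x i = rep m j i.
Proof.
elim: n => [|n [j jM H]]; first by exists 0%N; rewrite ?gen_base0.
exists (x n * M n + j)%N; first by rewrite block_lt ?ltn_coord.
move=> i; rewrite ltnS leq_eqVlt => /orP[/eqP ->|il].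
  apply: ord_inj; rewrite rep_val // digit_blockr // digit_mulr ?ltn_coord //.
by rewrite H //; apply: ord_inj; rewrite !rep_val // digit_blockl.
Qed.

Lemma level_decomp L (h : G -> R) x : level_fun L h ->
  h x = \sum_(j < M L) h (rep m j) * \1_(cylinder L (rep m j)) x.
Proof.
move=> hL; have [j jM xj] := cylinder_code L x.
rewrite (bigD1 (Ordinal jM)) //= big1 ?addr0 => [|i ij].
  by rewrite indicE mem_set ?mulr1 //; apply: hL.
rewrite indicE memNset ?mulr0 // => H.
case/eqP: ij; apply: val_inj => /=; apply: (digit_inj m_ge2 (ltn_ord i) jM) => k kL.
by rewrite -!rep_val // -H // xj.
Qed.

Lemma EFin_level_decomp L (h : G -> R) : level_fun L h ->
  (fun x => (h x)%:E) =
  (fun x => \sum_(j < M L) (h (rep m j) * \1_(cylinder L (rep m j)) x)%:E)%E.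
Proof. by move=> hL; apply: funext => x; rewrite sumEFin -level_decomp. Qed.

Lemma measurable_atom (c : R) L (y : G) :
  measurable_fun setT (fun x : G => ((c * \1_(cylinder L y) x))%:E).
Proof.
apply/measurable_EFinP; apply: measurable_funM => //.
exact: (measurable_indic (measurable_cylinder L y)).
Qed.

Lemma measurable_level L (h : G -> R) : level_fun L h ->
  measurable_fun setT (fun x : G => ((h x))%:E).
Proof.
move=> hL; rewrite (EFin_level_decomp hL).
by apply: emeasurable_sum => j; apply: measurable_atom.
Qed.

Lemma integral_level_sum L (h : G -> R) : level_fun L h -> (forall x, 0 <= h x) ->
  (\int[mu]_x (h x)%:E = (\sum_(j < M L) h (rep m j))%:E *
     mu (cylinder L vzero))%E.
Proof.
move=> hL h0; rewrite (EFin_level_decomp hL) ge0_integral_sum //; last 2 first.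
- by move=> j; apply: measurable_atom.
- by move=> j x _; rewrite lee_fin mulr_ge0.
rewrite -sumEFin ge0_sume_distrl; last by move=> j _; rewrite lee_fin.
apply: eq_bigr => j _.
rewrite (integralZl_indic _ (fun=> cylinder L (rep m j))) //.
- rewrite integral_indic //; last exact: measurable_cylinder.
  by rewrite setIT; congr (_ * _)%E; exact: mu_cylinder_rep.
- by move=> H; have := h0 (rep m j); rewrite leNgt H.
- exact: measurable_cylinder.
Qed.

(** The constant 1 is a sum of M_L cylinder indicators; by invariance these have equal mass, and the
    total mass is 1. *)
Lemma mu_cylinder L :
  mu (cylinder L vzero) = ((M L)%:R^-1)%:E :> \bar R.
Proof.
have := @integral_level_sum L (fun=> 1) (fun _ _ _ => erefl) (fun=> ler01).
rewrite integral_cst // mul1e sumr_const card_ord.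
rewrite [X in X = _ -> _](probability_setT mu : _ = 1%E).
set v := mu _ => H.
have vfin : v \is a fin_num by apply: fin_num_measure; apply: measurable_cylinder.
move: H; rewrite -(fineK vfin) -EFinM => -[] H; congr EFin.
by apply: (mulfI (lt0r_neq0 (natr_gen_base_gt0 R m_ge2 L))); rewrite -H divff // gt_eqF // natr_gen_base_gt0.
Qed.

Lemma integral_level L (h : G -> R) : level_fun L h -> (forall x, 0 <= h x) ->
  (\int[mu]_x (h x)%:E = (avg L h)%:E)%E.
Proof.
by move=> hL h0; rewrite (integral_level_sum hL h0) mu_cylinder -EFinM mulrC.
Qed.

(** Monotone convergence; the averages increase with L because [avg_level] lets b_i be averaged at
    any finer level. *)
Lemma integral_level_lim (b : nat -> G -> R) :
  (forall L, level_fun L (b L)) -> (forall L x, 0 <= b L x) ->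
  (forall L x, b L x <= b L.+1 x) ->
  (\int[mu]_x limn (fun L => (b L x)%:E) =
   ereal_sup (range (fun L => (avg L (b L))%:E)))%E.
Proof.
move=> bL b0 bS.
have bm x : {homo (b ^~ x) : i j / (i <= j)%N >-> (i <= j)%R}.
  by apply/nondecreasing_seqP => n.
rewrite monotone_convergence //; last 3 first.
- by move=> L; apply: measurable_level (bL L).
- by move=> L x _; rewrite lee_fin.
- by move=> x _ i j ij; rewrite lee_fin bm.
under eq_fun do rewrite (integral_level (bL _)) //.
apply/cvg_lim => //; apply: ereal_nondecreasing_cvgn => i j ij.
rewrite lee_fin -(avg_level m_ge2 ij (bL i)).
by apply: ler_avg => x; apply: bm.
Qed.

End haar.

(** * Fourier coefficients of a martingale *)

Section martingale_coefficients.
Variables (R : realType) (m : nat -> nat) (mu : probability (vilenkin m) R).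
Hypothesis m_ge2 : forall k, (2 <= m k)%N.
Local Notation M := (gen_base m).
Local Notation G := (vilenkin m).
Local Notation C := R[i].

(** Both S_{M_l} f^(k) and S_{M_l} f^(l) equal f^(l), and [coef_of_sum] recovers the coefficients
    from it. *)
Lemma martingale_fourier_eq (f : nat -> G -> C) l k j :
  martingale mu f -> (l <= k)%N -> (j < M l)%N ->
  fourier mu (f k) j = fourier mu (f l) j.
Proof.
move=> [_ _ mf] lk jl; have Ml0 : ((M l)%:R : C) != 0.
  by rewrite pnatr_eq0 -lt0n gen_base_gt0.
apply: (mulfI Ml0).
rewrite -(coef_of_sum m_ge2 (fourier mu (f k)) jl) (mf _ _ lk).
by rewrite -(coef_of_sum m_ge2 (fourier mu (f l)) jl) (mf _ _ (leqnn l)).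
Qed.

(** The sequence defining the limit is constant from l on. *)
Lemma mart_fourierE (f : nat -> G -> C) l j :
  martingale mu f -> (j < M l)%N -> mart_fourier mu f j = fourier mu (f l) j.
Proof.
move=> mf jl; rewrite /mart_fourier.
apply: (@lim_near_cst C^o (@norm_hausdorff C C^o)).
by exists l => // k /= lk; apply: martingale_fourier_eq.
Qed.

Lemma martingaleE (f : nat -> G -> C) l : martingale mu f ->
  f l = partial_sum (mart_fourier mu f) (M l).
Proof.
move=> mf; have [_ _ /(_ l l (leqnn l)) <-] := mf.
apply: funext => x; apply: eq_bigr => j _.
by rewrite (mart_fourierE mf (ltn_ord j)).
Qed.

End martingale_coefficients.

(** * Maxima of finitely many terms *)

Section finite_max.
Variable R : realType.

(** The index 0 is left out, as in the supremum of [T_maximal]; the start value 0 is harmless for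
    nonnegative terms. *)
Fixpoint max_upto (a : nat -> R) (n : nat) : R :=
  if n is n'.+1 then Num.max (max_upto a n') (a n) else 0.

Lemma max_upto_ge0 a n : 0 <= max_upto a n.
Proof. by elim: n => //= n IH; rewrite le_max IH. Qed.

Lemma le_max_upto a n N : (0 < n <= N)%N -> a n <= max_upto a N.
Proof.
move=> /andP[n0]; elim: N => [|N IH]; first by rewrite leqn0 => /eqP n0'; rewrite n0' in n0.
by rewrite leq_eqVlt ltnS /= le_max => /orP[/eqP ->|/IH ->//]; rewrite lexx orbT.
Qed.

Lemma max_upto_homo a : {homo max_upto a : i j / (i <= j)%N >-> i <= j}.
Proof. by apply/nondecreasing_seqP => n /=; rewrite le_max lexx. Qed.

Lemma max_upto_le a N c : 0 <= c -> (forall n, (0 < n <= N)%N -> a n <= c) ->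
  max_upto a N <= c.
Proof.
move=> c0; elim: N => //= N IH H; rewrite ge_max IH ?H //= ?leqnn // => n /andP[n0 nN].
by rewrite H // n0 (leqW nN).
Qed.

Lemma eq_max_upto a1 a2 N : (forall n, (n <= N)%N -> a1 n = a2 n) ->
  max_upto a1 N = max_upto a2 N.
Proof.
elim: N => //= N IH E; rewrite (E N.+1) // IH // => n nN.
by apply: E; apply: leqW.
Qed.

Lemma max_upto_ex a N : (forall n, 0 <= a n) ->
  exists2 n, (0 < n)%N & max_upto a N <= a n.
Proof.
move=> a0; elim: N => [|N [n n0 H]] /=; first by exists 1%N.
by case: (leP (a N.+1) (max_upto a N)) => _; [exists n|exists N.+1].
Qed.

End finite_max.

Lemma run_max_attained (R : realType) (m : nat -> nat) (p : R) (c : nat -> R[i]) L (x : vilenkin m) :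
  exists n, run_max p c L x =
    cabs (partial_sum c (gen_base m n) x : R[i]) `^ p :> R.
Proof.
elim: L => [|L [n IH]] /=; first by exists 0%N.
by case: leP => _; [exists L.+1|exists n].
Qed.

Theorem mainTheorem12 (R : realType) (m : nat -> nat)
    (mu : probability (vilenkin m) R) (p : R) (q : nat -> R) :
  bounded_vilenkin m ->
  normalized_haar mu ->
  0 < p <= 2^-1 ->
  (forall k, 0 <= q k) ->
  nonincreasing_seq q ->
  0 < q 0%N ->
  bounded_Hp_Lp mu p (T_maximal mu p q).
Proof.
move=> [m_ge2 [B mB]] haar /andP[p0 p12] q0 qS q00.
have [K K0 HK] := T_coef_maximal m_ge2 mB p0 p12 q0 qS q00.
(* K bounds integrals of p-th powers, hence the root. *)
exists (K `^ p^-1) => f [mf _].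
pose c := mart_fourier mu f.
pose a n (x : vilenkin m) := (cabs (T_coef q c n x) / log_weight p n) `^ p.
(* Cutting off at n <= M_L makes the maximum constant on cylinders of level L. *)
pose b L x := max_upto (a ^~ x) (gen_base m L).
have a0 n x : 0 <= a n x by apply: powR_ge0.
have b_level L : level_fun L (b L).
  move=> x y xy; rewrite /b.
  have E n : (n <= gen_base m L)%N -> a n x = a n y.
    by move=> nL; rewrite /a (T_coef_level m_ge2 q c nL xy).
  exact: eq_max_upto.
have bS L x : b L x <= b L.+1 x by apply/max_upto_homo/leq_gen_base.
have base_pos j x : (0 < j)%N -> 0 <= cabs (T_coef q c j x) / log_weight p j.
  by move=> j0; rewrite divr_ge0 ?cabs_ge0 // ltW // log_weight_gt0.
have wt_pos (j : nat) : 0 <= log_weight p j.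
  by rewrite mulr_ge0 ?powR_ge0 // exprz_ge0 // ln_ge0 // ler1n.
have T_lim x : (`|T_maximal mu p q f x| `^ p = limn (fun L => (b L x)%:E))%E.
  rewrite gee0_abs; last first.
    apply: (@le_trans _ _ (cabs (T_coef q c 1 x) / log_weight p 1)%:E).
      by rewrite lee_fin base_pos.
    by apply: ereal_sup_ubound; exists 1%N.
  apply: (poweR_sup_lim (a := fun n => cabs (T_coef q c n x) / log_weight p n)) => //.
  - by move=> n; rewrite divr_ge0 ?cabs_ge0.
  - by move=> i j ij; apply/max_upto_homo/leq_gen_base.
  - move=> n /= n0; exists n; apply: (@le_max_upto _ (a ^~ x)).
    by rewrite n0 ltnW // ltn_gen_base.
  - move=> L; have [n n0 H] := @max_upto_ex _ (a ^~ x) (gen_base m L) (a0^~ x).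
    by exists n.
have f_lim x : (`|maximal_function f x| `^ p = limn (fun L => (run_max p c L x)%:E))%E.
  rewrite gee0_abs; last first.
    apply: (@le_trans _ _ (cabs (f 0%N x))%:E); first by rewrite lee_fin cabs_ge0.
    by apply: ereal_sup_ubound; exists 0%N.
  apply: (poweR_sup_lim (a := fun n => cabs (f n x))) => //.
  - by move=> n; apply: cabs_ge0.
  - by apply/nondecreasing_seqP => n; apply: run_maxS.
  - move=> n _; exists n; rewrite (martingaleE m_ge2 n mf); exact: le_run_max.
  - move=> L; have [n H] := @run_max_attained R m p c L x.
    by exists n => //; rewrite (martingaleE m_ge2 n mf) -H.
rewrite /hardy_norm unlock /=.
(* Both norms become p-th roots of suprema over L of averages of level L, and the inequality is then
   proved for each L. *)
under eq_integral do rewrite T_lim.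
under [in leRHS]eq_integral do rewrite f_lim.
rewrite (integral_level_lim m_ge2 haar b_level) //; last first.
  by move=> L x; apply: max_upto_ge0.
rewrite (integral_level_lim m_ge2 haar (run_max_level p m_ge2 c)); last 2 first.
- exact: run_max_ge0.
- exact: run_maxS.
set X := ereal_sup (range (fun L => (avg L (run_max p c L))%:E)).
have X0 : (0 <= X)%E.
  apply: (@le_trans _ _ (avg 0 (run_max p c 0))%:E).
    by rewrite lee_fin avg_ge0 // => x; apply: run_max_ge0.
  by apply: ereal_sup_ubound; exists 0%N.
have pV : 0 <= p^-1 by rewrite invr_ge0 ltW.
rewrite -poweR_EFin -poweRM ?lee_fin //.
have inI (x : \bar R) : (0 <= x)%E -> (x \in `[0, +oo]%E)%E.
  by move=> x0; rewrite in_itv/= leey x0.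
apply: gt0_ler_poweR => //; rewrite ?inI ?mule_ge0 ?lee_fin //.
  apply: (@le_trans _ _ (avg 0 (b 0%N))%:E).
    by rewrite lee_fin avg_ge0 // => x; apply: max_upto_ge0.
  by apply: ereal_sup_ubound; exists 0%N.
apply: ge_ereal_sup => _ [L _ <-].
have [Th [HTh1 HTh2]] := HK c L.
apply: (@le_trans _ _ (K%:E * (avg L (run_max p c L))%:E)%E); last first.
  by rewrite lee_wpmul2l ?lee_fin //; apply: ereal_sup_ubound; exists L.
rewrite -EFinM lee_fin; apply: le_trans HTh2; apply: ler_avg => x.
have M0 := gen_base_gt0 m_ge2 L.
apply: max_upto_le => [|n nL]; last exact: HTh1.
(* The start value 0 of the maximum requires [Th] to be nonnegative, which the case n = 1 shows. *)
by apply: le_trans (HTh1 1%N x _); rewrite ?powR_ge0.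
Qed.
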